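(* Let $k$ be a field, $R=k[x,y]$, and let $E\subset R$ be a proper monomial ideal with $\dim_k R/E<\infty$. With $M_0(E)$, $T_i(E)$ and $V_i(E)$ ($i=0,1,2,3$) as defined in the context, the map $$\phi: T_0(E)\to V_0(E),\qquad N\mapsto \text{the ideal of } R \text{ generated by the } t\times t \text{ minors of } M_0(E)+N,$$ is well defined and is a bijection. Furthermore, for each $i=1,2,3$, the restriction of $\phi$ induces a bijection between $T_i(E)$ and $V_i(E)$.
   Context: $k$ is an arbitrary field and $R=k[x,y]$ carries the lexicographic term order with $x>y$. For $0\ne f\in R$, $\mathrm{Lt}(f)$ is the largest monomial occurring in $f$; for an ideal $I$, $\mathrm{Lt}(I)$ is the monomial ideal generated by all $\mathrm{Lt}(f)$, $f\in I\setminus\{0\}$. Numerical data of $E$. For a proper monomial ideal $E$ with $\dim_kR/E<\infty$ set $t=\min\{j: x^j\in E\}\ge 1$, and $m_i=\min\{j : x^{t-i}y^j\in E\}$ for $0\le i\le t$, so $0=m_0<m_1\le m_2\le\dots\le m_t$ and $E=(x^t,x^{t-1}y^{m_1},\dots,xy^{m_{t-1}},y^{m_t})$. Set $d_i=m_i-m_{i-1}$ for $i=1,\dots,t$. Set $u_{ij}=m_j-m_{i-1}+i-j$ for $1\le i\le t+1$, $1\le j\le t$, and $$\mathcal S(E)=\{(i,j): 1\le j<i\le t+1,\ 0\le u_{ij}<d_j\}.$$ $M_0(E)$ is the $(t+1)\times t$ matrix with $(i,i)$-entry $y^{d_i}$ and $(i+1,i)$-entry $-x$ for $i=1,\dots,t$,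 and all other entries $0$. Sets of ideals of $R$: - $V_0(E)=\{I : \mathrm{Lt}(I)=E\}$; - $V_1(E)=\{I : \mathrm{Lt}(I)=E \text{ and } y\in\sqrt I\}$; - $V_2(E)=\{I : \mathrm{Lt}(I)=E \text{ and } \sqrt I=(x,y)\}$; - $V_3(E)=\{I : \mathrm{Lt}(I)=E \text{ and } I \text{ is homogeneous (standard grading)}\}$. Sets of matrices. $T_0(E)$ is the set of $(t+1)\times t$ matrices $N=(n_{i,j})$ with $n_{i,j}=0$ if $i<j$, and $n_{i,j}\in k[y]$ a polynomial of degree $<d_j$ if $i\ge j$ (the zero polynomial is always allowed; if $d_j=0$ then $n_{i,j}=0$). Consider the conditions: (1) $n_{i,i}=0$ for all $i=1,\dots,t$. (2) For every $j$ with $d_j>0$, the polynomial $n_{i,j}$ has zero constant term for every $i=j+1,\dots,k_j+1$, where $k_j=\max\{v: j\le v\le t,\ m_v=m_j\}$. (3) $n_{i,j}=0$ if $(i,j)\notin\mathcal S(E)$, and $n_{i,j}=p_{ij}y^{u_{ij}}$ with $p_{ij}\in k$ if $(i,j)\in\mathcal S(E)$. Then $T_1(E)$ is the set of $N\in T_0(E)$ satisfying (1); $T_2(E)$ the set of $N\in T_0(E)$ satisfying (1) and (2); $T_3(E)$ the set of $N\in T_0(E)$ satisfying (3). *)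

(* Defs.v *)
From HB Require Import structures.
From mathcomp Require Import all_boot all_order all_algebra.
From mathcomp Require Import all_classical.
Set Implicit Arguments.
Unset Strict Implicit.
Unset Printing Implicit Defensive.
Import Order.TTheory GRing.Theory Num.Theory.
Local Open Scope classical_set_scope.
Local Open Scope ring_scope.

(* As in polyXY, k[x,y] is {poly {poly k}} with x := 'X (outer variable) and
   y := 'Y = 'X%:P (inner variable); k[y] is {poly k}, embedded by polyC.
   The coefficient of x^a y^b in f is f`_a`_b. *)
Notation biv k := {poly {poly k}}.

(* The exponent (a, b) stands for x^a y^b. The lexicographic product order on
   nat * nat is the lexicographic term order with x > y. *)
Notation expo := (nat *l nat)%type.

Section Ideals.
Context {k : fieldType}.
Implicit Types (I G : set (biv k)) (f : biv k) (a : expo).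

Definition is_ideal I : Prop :=
  [/\ I 0,
      forall f g, I f -> I g -> I (f + g)
    & forall f g, I g -> I (f * g)].

Definition ideal_gen G : set (biv k) := smallest is_ideal G.

Definition radical I : set (biv k) := [set f | exists n : nat, I (f ^+ n)].

Definition monom a : biv k := 'X^(a.1) * 'Y^+(a.2).

Definition occurs a f : Prop := f`_(a.1)`_(a.2) != 0.

Definition is_leading a f : Prop :=
  occurs a f /\ forall b : expo, occurs b f -> (b <= a)%O.

Definition Lt_ideal I : set (biv k) :=
  ideal_gen
    [set g | exists f a, [/\ I f, f != 0, is_leading a f & g = monom a]].

Definition monomial_ideal I : Prop :=
  exists A : set expo, I = ideal_gen (monom @` A).

Definition homogeneous f : Prop :=
  exists d : nat, forall a, occurs a f -> (a.1 + a.2 = d)%N.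

Definition homogeneous_ideal I : Prop :=
  exists2 G, G `<=` homogeneous & I = ideal_gen G.

(* dim_k (R / I) < oo: finitely many classes span R / I over k. *)
Definition finite_codim I : Prop :=
  exists s : seq (biv k), forall f,
    exists c : 'I_(size s) -> k, I (f - \sum_(i < size s) (c i)%:P *: s`_i).

End Ideals.

(* The least element of P; the value 0 for empty P is never relevant. *)
Definition min_nat (P : set nat) : nat :=
  xget 0%N [set n | P n /\ forall p, P p -> (n <= p)%N].

(* The indices i, j of d_i, u_ij, S(E) and k_j are 1-based (m_i starts at m_0).
   Since 'I_n is 0-based, the entry in row r and column c of a matrix
   is the (r.+1, c.+1)-entry in 1-based numbering. *)
Section Data.
Context {k : fieldType} (E : set (biv k)).

Definition tE : nat := min_nat [set j | E 'X^j].

Definition mE (i : nat) : nat := min_nat [set j | E ('X^(tE - i) * 'Y^+j)].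

Definition dE (i : nat) : nat := (mE i - mE i.-1)%N.

Definition uE (i j : nat) : int :=
  (mE j)%:Z - (mE i.-1)%:Z + i%:Z - j%:Z.

Definition SE (i j : nat) : bool :=
  (1 <= j < i)%N && (i <= tE.+1)%N && (0 <= uE i j < (dE j)%:Z).

(* k_j = max {v : j <= v <= t, m_v = m_j} *)
Definition kE (j : nat) : nat := \max_(j <= v < tE.+1 | mE v == mE j) v.

Definition M0 : 'M[biv k]_(tE.+1, tE) :=
  \matrix_(r, c)
    if r == c :> nat then 'Y^+(dE c.+1)
    else if r == c.+1 :> nat then - 'X else 0.

(* The set of t x t minors of a (t+1) x t matrix: row' r deletes row r. *)
Definition max_minors (t : nat) (A : 'M[biv k]_(t.+1, t)) : set (biv k) :=
  [set \det (row' r A) | r in [set: 'I_t.+1]].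

Definition phi (N : 'M[{poly k}]_(tE.+1, tE)) : set (biv k) :=
  ideal_gen (max_minors (M0 + map_mx polyC N)).

Definition V0 : set (set (biv k)) := [set I | is_ideal I /\ Lt_ideal I = E].

Definition V1 : set (set (biv k)) :=
  [set I | [/\ is_ideal I, Lt_ideal I = E & radical I 'Y]].

Definition V2 : set (set (biv k)) :=
  [set I | [/\ is_ideal I, Lt_ideal I = E
             & radical I = ideal_gen [set 'X; 'Y]]].

Definition V3 : set (set (biv k)) :=
  [set I | [/\ is_ideal I, Lt_ideal I = E & homogeneous_ideal I]].

(* size p is 1 + deg p, and 0 for p = 0, so size p <= d says that p = 0 or
   deg p < d. *)
Definition T0 : set 'M[{poly k}]_(tE.+1, tE) :=
  [set N : 'M[{poly k}]_(tE.+1, tE) |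
   forall (r : 'I_tE.+1) (c : 'I_tE),
     ((r < c)%N -> N r c = 0) /\
     ((c <= r)%N -> (size (N r c) <= dE c.+1)%N)].

Definition cond1 (N : 'M[{poly k}]_(tE.+1, tE)) : Prop :=
  forall (r : 'I_tE.+1) (c : 'I_tE), r = c :> nat -> N r c = 0.

Definition cond2 (N : 'M[{poly k}]_(tE.+1, tE)) : Prop :=
  forall c : 'I_tE, (0 < dE c.+1)%N ->
  forall r : 'I_tE.+1, (c.+2 <= r.+1 <= (kE c.+1).+1)%N -> (N r c)`_0 = 0.

(* On S(E) the exponent u_ij is nonnegative, hence equal to its absolute
   value. *)
Definition cond3 (N : 'M[{poly k}]_(tE.+1, tE)) : Prop :=
  forall (r : 'I_tE.+1) (c : 'I_tE),
    if SE r.+1 c.+1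
    then exists p : k, N r c = p *: 'X^(`|uE r.+1 c.+1|%N)
    else N r c = 0.

Definition T1 : set 'M[{poly k}]_(tE.+1, tE) := [set N | T0 N /\ cond1 N].
Definition T2 : set 'M[{poly k}]_(tE.+1, tE) :=
  [set N | [/\ T0 N, cond1 N & cond2 N]].
Definition T3 : set 'M[{poly k}]_(tE.+1, tE) := [set N | T0 N /\ cond3 N].

End Data.

Arguments M0 {k} E.
Arguments phi {k} E N.
Arguments T0 {k} E _.
Arguments T1 {k} E _.
Arguments T2 {k} E _.
Arguments T3 {k} E _.
Arguments cond1 {k} E N.
Arguments cond2 {k} E N.
Arguments cond3 {k} E N.

(* Main.v *)
From HB Require Import structures.
Require Import Defs.
From mathcomp Require Import all_boot all_order all_algebra.
From mathcomp Require Import all_classical.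
From mathcomp Require Import zify.
Set Implicit Arguments.
Unset Strict Implicit.
Unset Printing Implicit Defensive.
Import Order.TTheory GRing.Theory Num.Theory.
Local Open Scope classical_set_scope.
Local Open Scope ring_scope.

(** View k[x,y] as k[y][x]. For an ideal I, the leading coefficients of the
    elements of I of x-degree at most t - r form an ideal of k[y]; let D_r be
    its monic generator. Saying that Lt(I) = E amounts to saying that
    deg D_r = m_r for all r ([staircase_of_echelon], [echelon_of_staircase]).
    Choose f_0, ..., f_t in I such that f_r has x-degree t - r and leading
    coefficient D_r. By descent on the x-degree, f_1, ..., f_t together with
    the products x^i f_0 form a basis of I over k[y].

    Multiplication by x yields relations
      x f_(c+1) = b_(c,c) f_c + sum_(r > c) b_(r,c) f_r,
    where b_(c,c) = D_(c+1) / D_c has degree d_(c+1): these are the columns of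
    a Hilbert-Burch matrix M_0(E) + N. Replacing f_c by f_c + sum_(r > c) s_r f_r
    changes b_(r,c) by a multiple of b_(c,c), so Euclidean division makes
    deg b_(r,c) < d_(c+1), which is the degree bound defining T_0(E), and the
    division is unique. Since f_t = D_t is forced, descending induction on c
    shows that every I in V_0(E) has exactly one normalized family f and
    matrix b ([exists_resolution], [resolution_unique]).

    Conversely, for N in T_0(E), the determinant of M_0(E) + N with one column
    repeated vanishes, so the signed maximal minors satisfy the relations
    above, and the minor avoiding the last row is the product D_t of the
    diagonal ([signed_minor_resolves]). The relations and D_t determine the
    whole family, so the minors are the family f of the ideal that they
    generate. This gives the bijection from T_0(E) to V_0(E), and for the other
    three it suffices to compare conditions on N and on I.

    Condition (1): the intersection of I with k[y] is generated by
    D_t = prod_c b_(c,c), so y is in the radical of I iff every b_(c,c) is a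
    power of y ([cond1P]).

    Condition (2): when (1) holds, f_r = y^(m_r) P_r, and modulo y the ideal I
    becomes the ideal of k[x] generated by P_0(x,0), which is monic of degree
    t. Hence x is in the radical iff P_0(x,0) = x^t. The relations between the
    P_r(x,0) involve exactly the constant terms named in (2), and following
    them along the plateaus of m shows that P_0(x,0) = x^t iff these constant
    terms vanish ([monic_powers_iff], [cond2_radical]).

    Condition (3): it says that every entry of M_0(E) + N is homogeneous of the
    degree for which all terms of a column relation have the same degree, with
    f_r of degree t - r + m_r. If I is homogeneous, the homogeneous component
    of a relation is another normalized relation in I, so it is the same one
    by uniqueness ([cond3P]). *)

(** * Ideals, monomial ideals and leading exponents *)

Section Ideals.
Context {k : fieldType}.
Implicit Types (I G : set (biv k)) (f g : biv k).

Lemma ideal_gen_ideal G : is_ideal (ideal_gen G).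
Proof.
split=> [|f g If Ig|f g Ig] J [iJ GJ].
- by case: iJ.
- by case: (iJ) => _ + _; apply; [exact: If|exact: Ig].
- by case: (iJ) => _ _; apply; exact: Ig.
Qed.

Lemma sub_ideal_gen G : G `<=` ideal_gen G.
Proof. exact: sub_gen_smallest. Qed.

Lemma ideal_gen_sub G I : is_ideal I -> G `<=` I -> ideal_gen G `<=` I.
Proof. by move=> iI GI; apply: smallest_sub. Qed.

Section IdealOps.
Variables (I : set (biv k)) (iI : is_ideal I).

Lemma ideal0 : I 0. Proof. by case: iI. Qed.
Lemma idealD f g : I f -> I g -> I (f + g). Proof. by case: iI => _ + _; apply. Qed.
Lemma idealM f g : I g -> I (f * g). Proof. by case: iI => _ _; apply. Qed.
Lemma idealZ (c : {poly k}) g : I g -> I (c *: g).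
Proof. by rewrite -mul_polyC; apply: idealM. Qed.
Lemma idealN f : I f -> I (- f).
Proof. by rewrite -mulN1r; apply: idealM. Qed.
Lemma idealB f g : I f -> I g -> I (f - g).
Proof. by move=> If Ig; apply: idealD => //; apply: idealN. Qed.
Lemma ideal_sum (J : Type) (s : seq J) (P : pred J) (F : J -> biv k) :
  (forall i, P i -> I (F i)) -> I (\sum_(i <- s | P i) F i).
Proof. by move=> IF; apply: big_ind => //; [exact: ideal0|exact: idealD]. Qed.
End IdealOps.

(** To recognize an ideal of k[y][x] it is enough to multiply by x and by
    scalars of k[y]; this is how the span of the minors is shown to be one. *)
Lemma is_idealXZ (J : set (biv k)) :
    J 0 -> (forall f g, J f -> J g -> J (f + g)) ->
    (forall (c : {poly k}) g, J g -> J (c *: g)) ->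
    (forall g, J g -> J ('X * g)) -> is_ideal J.
Proof.
move=> J0 JD JZ JX; split => // f g Jg.
elim/poly_ind: f => [|p c IH]; first by rewrite mul0r.
rewrite mulrDl -mulrA mul_polyC mulrCA; apply: JD; last exact: JZ.
exact: JX.
Qed.

(** The same reduction carried down to k, for sets described by their
    monomials or by their homogeneous components. *)
Lemma is_idealXYZ (J : set (biv k)) :
    J 0 -> (forall f g, J f -> J g -> J (f + g)) ->
    (forall (c : k) g, J g -> J (c%:P *: g)) ->
    (forall g, J g -> J ('X * g)) -> (forall g, J g -> J ('X *: g)) ->
  is_ideal J.
Proof.
move=> J0 JD JC JX JY; apply: is_idealXZ => // c g Jg.
elim/poly_ind: c => [|p c IH]; first by rewrite scale0r.
by rewrite scalerDl mulrC -scalerA; apply: JD; [exact: JY|exact: JC].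
Qed.

Lemma coef_monom (a b : expo) : (monom a : biv k)`_(b.1)`_(b.2) = (b == a)%:R.
Proof.
rewrite /monom mulrC -rmorphXn /= coefCM coefXn.
case: a b => [a1 a2] [b1 b2] /=; rewrite xpair_eqE.
by case: (b1 == a1); rewrite ?mulr0 ?coef0 // mulr1 coefXn.
Qed.

Lemma biv_eqP f g : (forall i j, f`_i`_j = g`_i`_j) <-> f = g.
Proof. by split=> [H|->//]; apply/polyP => i; apply/polyP => j. Qed.

Lemma ideal_of_occurs I f : is_ideal I ->
  (forall a, occurs a f -> I (monom a)) -> I f.
Proof.
move=> iI Ia; rewrite -(coefK f) poly_def; apply: ideal_sum => // i _.
rewrite -(coefK f`_i) poly_def scaler_suml; apply: ideal_sum => // j _.
have [->|nz] := eqVneq f`_i`_j 0; first by rewrite !scale0r; apply: ideal0.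
rewrite -[f`_i`_j *: _]mul_polyC -scalerA; apply: idealZ => //.
by rewrite -mul_polyC mulrC rmorphXn /=; apply: (Ia (i : nat, j : nat)).
Qed.

(** The polynomials whose monomials are all divisible by a generator form an
    ideal, because multiplying by x or y only shifts exponents up. *)
Lemma monomial_idealE (A : set expo) f : ideal_gen (monom @` A) f <->
  forall a, occurs a f -> exists2 b, A b & (b.1 <= a.1)%N && (b.2 <= a.2)%N.
Proof.
split; last first.
  move=> H; apply: ideal_of_occurs; first exact: ideal_gen_ideal.
  move=> a /H [b Ab /andP[b1 b2]].
  have -> : monom a = monom (a.1 - b.1, a.2 - b.2)%N * monom b :> biv k.
    by rewrite /monom /= mulrACA -!exprD !subnK.
  by apply: (idealM (ideal_gen_ideal _)); apply: sub_ideal_gen; exists b.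
pose J : set (biv k) := [set g | forall a, occurs a g ->
  exists2 b : expo, A b & (b.1 <= a.1)%N && (b.2 <= a.2)%N].
suff H : ideal_gen (monom @` A) `<=` J by exact: H.
apply: ideal_gen_sub; last first.
  move=> _ [a Aa <-] b; rewrite /occurs coef_monom.
  by have [-> _|_] := eqVneq b a; [exists a; rewrite ?leqnn|rewrite eqxx].
apply: is_idealXYZ => [a|g h Hg Hh a|c g Hg a|g Hg [[|i] j]|g Hg [i [|j]]];
    rewrite /occurs.
- by rewrite !coef0 eqxx.
- rewrite !coefD; have [g0|/Hg //] := eqVneq (g`_(a.1)`_(a.2)) 0.
  by rewrite g0 add0r => /Hh.
- rewrite coefZ coefCM => nz; apply: Hg; apply: contraNneq nz => ->.
  by rewrite mulr0.
- by rewrite mulrC coefMX coef0 eqxx.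
- rewrite mulrC coefMX /= => /(Hg (i, j))[b Ab /andP[b1 b2]].
  by exists b => //; rewrite b2 (leq_trans b1).
- by rewrite coefZ mulrC coefMX eqxx.
- rewrite coefZ mulrC coefMX /= => /(Hg (i, j))[b Ab /andP[b1 b2]].
  by exists b => //; rewrite b1 (leq_trans b2).
Qed.

Lemma is_leadingP f (a b : nat) : is_leading (a, b) f <->
  size f = a.+1 /\ size (lead_coef f) = b.+1.
Proof.
split=> [[occ ub]|[sf sc]].
- have sf : size f = a.+1.
    apply/eqP; rewrite eqn_leq; apply/andP; split; last first.
      rewrite ltnNge; apply: contraNN occ => /leq_sizeP ->//.
      by rewrite coef0.
    rewrite leqNgt; apply/negP => lt.
    have fn0 : f != 0 by rewrite -size_poly_gt0 (leq_trans _ lt).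
    have := ub ((size f).-1, (size (lead_coef f)).-1).
    rewrite /occurs /= -!lead_coefE !lead_coef_eq0 fn0 leEprodlexi /= => /(_ isT).
    case/andP; rewrite leEnat => h _; move: lt.
    by rewrite -(prednK (n := size f)) ?size_poly_gt0 // ltnNge ltnS h.
  split=> //; have fa : lead_coef f = f`_a by rewrite lead_coefE sf.
  have fn0 : lead_coef f != 0 by rewrite lead_coef_eq0 -size_poly_eq0 sf.
  apply/eqP; rewrite eqn_leq; apply/andP; split; last first.
    rewrite ltnNge; apply: contraNN occ => /leq_sizeP h.
    by rewrite -fa /= h.
  have := ub (a, (size (lead_coef f)).-1).
  rewrite /occurs /= -fa -lead_coefE lead_coef_eq0 fn0 leEprodlexi /= => /(_ isT).
  rewrite lexx /= leEnat => h.
  by rewrite -(prednK (n := size (lead_coef f))) ?size_poly_gt0.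
- have fa : lead_coef f = f`_a by rewrite lead_coefE sf.
  have fn0 : lead_coef f != 0 by rewrite lead_coef_eq0 -size_poly_eq0 sf.
  split.
    by rewrite /occurs /= -fa -[b]/(b.+1.-1) -sc -lead_coefE lead_coef_eq0.
  move=> [i j]; rewrite /occurs leEprodlexi /= !leEnat => occ.
  have ia : (i <= a)%N.
    rewrite -ltnS -sf ltnNge; apply: contraNN occ => /leq_sizeP ->//.
    by rewrite coef0.
  rewrite ia; apply/implyP => ai.
  have {ia ai}ei : i = a by apply/eqP; rewrite eqn_leq ia.
  rewrite -ltnS -sc ltnNge; apply: contraNN occ => /leq_sizeP h.
  by rewrite ei -fa h.
Qed.

(** The leading exponent for x > y is the x-degree, followed by the y-degree
    of the leading coefficient in k[y]. *)
Definition lead_expo I (a b : nat) : Prop :=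
  exists g : biv k, [/\ I g, size g = a.+1 & size (lead_coef g) = b.+1].

Lemma monom_leading (a : expo) : is_leading a (monom a : biv k).
Proof.
split; first by rewrite /occurs coef_monom eqxx oner_eq0.
by move=> b; rewrite /occurs coef_monom; have [->//|_] := eqVneq b a; rewrite eqxx.
Qed.

(** The leading exponents of an ideal are closed under increasing either
    coordinate, so passing to the generated monomial ideal adds none. *)
Lemma mem_lead_expo I a b : is_ideal I -> Lt_ideal I (monom (a, b)) ->
  lead_expo I a b.
Proof.
move=> iI.
have -> : Lt_ideal I = ideal_gen (monom @` [set c | lead_expo I c.1 c.2]).
  congr ideal_gen; apply/seteqP; split=> g /=.
    move=> [f [[c d] [If _ /is_leadingP[sf sc] ->]]]; exists (c, d) => //.
    by exists f.
  move=> [[c d] [f [If sf sc] <-]]; exists f, (c, d); split => //.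
    by rewrite -size_poly_eq0 sf.
  by apply/is_leadingP.
move/monomial_idealE => /(_ (a, b)) []; first exact: (monom_leading _).1.
move=> [c d] [g [Ig sg sc]] /= /andP[ca db].
rewrite /= in sg sc.
exists ('X^(a - c) * ('X^(b - d) *: g)); split.
- by apply: idealM => //; apply: idealZ.
- have sXg : size ('X^(b - d) *: g) = c.+1.
    by rewrite size_scale // -size_poly_eq0 size_polyXn.
  by rewrite [_ * _]mulrC size_mulXn ?sXg -?size_poly_eq0 ?sXg //; lia.
- rewrite lead_coefM lead_coefXn mul1r lead_coefZ mulrC size_mulXn ?sc; first by lia.
  by rewrite -size_poly_eq0 sc.
Qed.

(** Equality of monomial ideals is thus tested on exponents; from here on
    Lt(I) = E is only used in this form. *)
Lemma Lt_idealE I E : is_ideal I -> monomial_ideal E ->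
  Lt_ideal I = E <-> (forall a b, lead_expo I a b <-> E (monom (a, b))).
Proof.
move=> iI [A EA]; have iE : is_ideal E by rewrite EA; apply: ideal_gen_ideal.
have lead_mem a b : lead_expo I a b -> Lt_ideal I (monom (a, b)).
  move=> [f [If sf sc]]; apply: sub_ideal_gen; exists f, (a, b); split=> //.
    by rewrite -size_poly_eq0 sf.
  exact/is_leadingP.
split=> [<- a b|H]; first by split; [exact: lead_mem|exact: mem_lead_expo].
apply/seteqP; split.
  apply: ideal_gen_sub => // _ [f [[a b] [If _ /is_leadingP[sf sc] ->]]].
  by apply/H; exists f.
rewrite EA; apply: ideal_gen_sub; first exact: ideal_gen_ideal.
move=> _ [[a b] Aab <-]; apply: lead_mem; rewrite H.
by rewrite EA; apply: sub_ideal_gen; exists (a, b).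
Qed.

End Ideals.

(** * The staircase of a monomial ideal of finite codimension *)

Section Staircase.
Context {k : fieldType}.

Lemma min_natP (P : set nat) : (exists n, P n) ->
  P (min_nat P) /\ forall n, P n -> (min_nat P <= n)%N.
Proof.
move=> exP; rewrite /min_nat; apply: (@xgetPex _ 0%N [set n | P n /\ _]).
have exb : exists n, `[< P n >] by case: exP => n Pn; exists n; apply/asboolP.
case: (ex_minnP exb) => n /asboolP Pn min.
by exists n; split => // p Pp; apply: min; apply/asboolP.
Qed.

(** With n elements spanning the quotient, any n + 1 vectors are dependent
    modulo E: the coefficients come from the kernel of an (n + 1) x n matrix.
    Applied to powers of x or of y, this produces a pure power in E. *)
Lemma finite_codim_dependent (E : set (biv k)) (v : nat -> biv k) :
    is_ideal E -> finite_codim E ->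
  exists n (c : 'rV[k]_n), c != 0 /\ E (\sum_(i < n) (c 0 i)%:P *: v i).
Proof.
move=> iE [s span]; pose n := size s.
have [C HC] := choice (fun i : 'I_n.+1 => span (v i)).
pose M := \matrix_(i, j) C i j.
have : kermx M != 0.
  by rewrite kermx_eq0 /row_free neq_ltn (leq_ltn_trans (rank_leq_col M)).
case/rowV0Pn => c /sub_kermxP cM0 c0; exists n.+1, c; split => //.
(* Since c M = 0, subtracting from each v i its combination of the spanning
   family does not change the sum, and makes every term an element of E. *)
have -> : \sum_i (c 0 i)%:P *: v i =
    \sum_i (c 0 i)%:P *: (v i - \sum_(j < n) (C i j)%:P *: s`_j).
  rewrite [RHS](eq_bigr _ (fun i _ => scalerBr _ _ _)) sumrB.
  rewrite (_ : \sum_(i < n.+1) _ *: (\sum_(j < n) _) = 0) ?subr0 //.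
  rewrite (eq_bigr (fun i => \sum_(j < n) (c 0 i * M i j)%:P *: s`_j)).
    rewrite exchange_big big1 // => j _; rewrite -scaler_suml -rmorph_sum /=.
    by have /matrixP/(_ 0 j) := cM0; rewrite !mxE => ->; rewrite scale0r.
  move=> i _; rewrite scaler_sumr; apply: eq_bigr => j _.
  by rewrite scalerA -polyCM mxE.
by apply: ideal_sum => // i _; apply: idealZ.
Qed.

Section Monomial.
Variable E : set (biv k).
Hypotheses (E_monomial : monomial_ideal E) (E_proper : E <> setT).
Hypothesis E_finite : finite_codim E.

Lemma monomial_is_ideal : is_ideal E.
Proof. by case: E_monomial => A ->; apply: ideal_gen_ideal. Qed.

Let iE := monomial_is_ideal.

Lemma monomial_ideal_occurs f a : E f -> occurs a f -> E (monom a).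
Proof.
case: E_monomial => A ->; rewrite !monomial_idealE => H occ b.
have [->|ne] := eqVneq b a; first by move=> _; apply: H.
by rewrite /occurs coef_monom (negPf ne) eqxx.
Qed.

Lemma powX_mem : exists n, E 'X^n.
Proof.
have [n [c [c0 Ec]]] := finite_codim_dependent (fun i => 'X^i) iE E_finite.
have [i ci] : exists i, c 0 i != 0.
  by case/eqP/rowP/existsNP: c0 => i; rewrite mxE => /eqP; exists i.
exists i; have := monomial_ideal_occurs (a := (i : nat, 0%N)) Ec.
rewrite /monom /= expr0 mulr1; apply.
rewrite /occurs coef_sum (bigD1 i) //= big1 => [|j ji].
  by rewrite coefZ coefXn eqxx mulr1 addr0 coefC.
by rewrite coefZ coefXn val_eqE eq_sym (negPf ji) mulr0.
Qed.

Lemma powY_mem : exists n, E ('Y^+n).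
Proof.
have [n [c [c0 Ec]]] := finite_codim_dependent (fun i => 'Y^+i) iE E_finite.
have [i ci] : exists i, c 0 i != 0.
  by case/eqP/rowP/existsNP: c0 => i; rewrite mxE => /eqP; exists i.
exists i; have := monomial_ideal_occurs (a := (0%N, i : nat)) Ec.
rewrite /monom /= mul1r; apply.
rewrite /occurs coef_sum coef_sum (bigD1 i) //= big1 => [|j ji].
  by rewrite coefZ -rmorphXn /= coefC /= coefCM coefXn eqxx mulr1 addr0.
by rewrite coefZ -rmorphXn /= coefC /= coefCM coefXn val_eqE eq_sym (negPf ji) mulr0.
Qed.

Lemma mem_powX j : E 'X^j <-> (tE E <= j)%N.
Proof.
have [Et min] := min_natP powX_mem; split; first exact: min.
by move=> tj; rewrite -(subnK tj) exprD; apply: idealM.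
Qed.

Lemma mem_staircase i j : E ('X^(tE E - i) * 'Y^+j) <-> (mE E i <= j)%N.
Proof.
have ex : exists j, E ('X^(tE E - i) * 'Y^+j).
  by have [n En] := powY_mem; exists n; apply: idealM.
have [Em min] := min_natP ex; split; first exact: min.
by move=> mj; rewrite -(subnK mj) exprD mulrCA; apply: idealM.
Qed.

Lemma tE_gt0 : (0 < tE E)%N.
Proof.
rewrite lt0n; apply/eqP => t0; apply: E_proper; apply/seteqP; split => // f _.
by rewrite -(mulr1 f); apply: idealM => //; apply/(mem_powX 0); rewrite t0.
Qed.

Lemma mE0 : mE E 0 = 0%N.
Proof.
apply/eqP; rewrite -leqn0; apply/mem_staircase.
by rewrite subn0 expr0 mulr1; apply/mem_powX.
Qed.

Lemma mE1_gt0 : (0 < mE E 1)%N.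
Proof.
rewrite ltnNge; apply/negP => /mem_staircase; rewrite mulr1 => /mem_powX.
by have := tE_gt0; lia.
Qed.

Lemma mE_homo : {homo mE E : i j / (i <= j)%N}.
Proof.
move=> i j ij; apply/mem_staircase.
have -> : (tE E - i = (tE E - i - (tE E - j)) + (tE E - j))%N by lia.
by rewrite exprD -mulrA; apply: idealM => //; apply/mem_staircase.
Qed.

(** For a >= t the truncated difference t - a is 0 and m_0 = 0, so a single
    inequality describes the whole staircase. *)
Lemma mem_monom a b : E (monom (a, b)) <-> (mE E (tE E - a) <= b)%N.
Proof.
have [at_|ta] := leqP a (tE E).
  by rewrite -{1}(subKn at_); apply: mem_staircase.
have -> : (tE E - a = 0)%N by lia.
rewrite mE0; split => // _; rewrite /monom mulrC; apply: idealM => //.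
by apply/mem_powX; apply: ltnW.
Qed.

End Monomial.
End Staircase.

(** * Echelon families over k[y] *)

Section Echelon.
Context {k : fieldType}.
Variables (t : nat).
Implicit Types (D : nat -> {poly k}) (f : nat -> biv k) (I : set (biv k)).

Definition echelon D f : Prop := forall r, (r <= t)%N ->
  (size (f r) <= (t - r).+1)%N /\ (f r)`_(t - r) = D r.

(** Combined with an echelon family in I, this says that D r generates the
    ideal of leading coefficients of I in x-degree t - r. *)
Definition leads_divisible D I : Prop := forall r (g : biv k), (r <= t)%N -> I g ->
  (size g <= (t - r).+1)%N -> D r %| g`_(t - r).

(** Triangular elimination: the family has strictly decreasing x-degrees, so
    the coefficients s_0, s_1, ... are killed in turn by looking at the
    coefficients of x^t, x^(t - 1), ... *)
Lemma echelon_coef0 D f (s : nat -> {poly k}) j :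
    echelon D f -> (forall r, (r <= t)%N -> D r != 0) -> (j <= t.+1)%N ->
    (forall i, (i < j)%N -> (\sum_(0 <= r < t.+1) s r *: f r)`_(t - i) = 0) ->
  forall i, (i < j)%N -> s i = 0.
Proof.
move=> ech Dn0 jt coef0; elim/ltn_ind => i IH ij.
have it : (i <= t)%N by lia.
have := coef0 i ij; rewrite big_mkord coef_sum.
rewrite (bigD1 (Ordinal (it : (i < t.+1)%N))) //= big1 => [|r]; last first.
  rewrite -val_eqE /= => ri; rewrite coefZ.
  have [ltri|leir] := ltnP r i; first by rewrite IH ?mul0r //; lia.
  have [sz _] := ech r (ltn_ord r).
  by rewrite (leq_sizeP _ _ sz) ?mulr0 //; have := ltn_ord r; lia.
rewrite coefZ (ech i it).2 addr0 => /eqP.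
by rewrite mulf_eq0 (negPf (Dn0 i it)) orbF => /eqP.
Qed.

Lemma echelon_free D f (s : nat -> {poly k}) c :
    echelon D f -> (forall r, (r <= t)%N -> D r != 0) ->
    \sum_(c <= r < t.+1) s r *: f r = 0 ->
  forall r, (c <= r <= t)%N -> s r = 0.
Proof.
move=> ech Dn0 s0 r /andP[cr rt].
have ct : (c <= t.+1)%N by lia.
pose s' i := if (c <= i)%N then s i else 0.
have: s' r = 0; last by rewrite /s' cr.
apply: (@echelon_coef0 D f s' t.+1) => // i _.
rewrite (big_cat_nat (n := c)) //= big_nat_cond big1 => [|j]; last first.
  by rewrite /s' andbT => /andP[_ jc]; rewrite leqNgt jc /= scale0r.
rewrite add0r big_nat_cond (eq_bigr (fun j => s j *: f j)) => [|j]; last first.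
  by rewrite /s' andbT => /andP[-> _].
by rewrite -big_nat_cond s0 coef0.
Qed.

(** Descent on the x-degree: subtracting a multiple of f_c removes the
    coefficient of x^(t - c), which D_c divides. *)
Lemma echelon_span D f I : is_ideal I ->
    (forall r, (r <= t)%N -> I (f r)) -> echelon D f -> leads_divisible D I ->
  forall c g, I g -> (c <= t.+1)%N -> (size g <= t.+1 - c)%N ->
  exists s, g = \sum_(c <= r < t.+1) s r *: f r.
Proof.
move=> iI If ech div c g Ig ct; have [n] := ubnP (t.+1 - c).
elim: n => // n IH in c g Ig ct *; move=> tcn sg.
have [ct'|ct'] := eqVneq c t.+1.
  exists (fun=> 0); rewrite big_geq ?ct' //.
  by apply/eqP; rewrite -size_poly_leq0; move: sg; lia.
have {ct'}ct : (c <= t)%N by lia.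
have /dvdpP[q qD] : D c %| g`_(t - c) by apply: div => //; lia.
have [szf lcf] := ech c ct.
have [||||s Hs] := IH c.+1 (g - q *: f c).
- by apply: idealB => //; apply: idealZ => //; apply: If.
- by lia.
- by lia.
- apply/leq_sizeP => j; rewrite leq_eqVlt => /orP[/eqP <-|tj].
    by rewrite coefB coefZ subSS lcf qD subrr.
  rewrite coefB coefZ (leq_sizeP _ _ sg) ?(leq_sizeP _ _ szf) ?mulr0 ?subrr //; lia.
exists (fun r => if r == c then q else s r).
rewrite big_ltn // eqxx; apply/eqP; rewrite addrC -subr_eq Hs; apply/eqP.
apply: eq_big_nat => r /andP[cr _].
by rewrite gtn_eqF.
Qed.

(** Division by the monic f_0 brings the x-degree below t, where the family
    spans over k[y]. *)
Lemma echelon_ideal_gen D f I : is_ideal I ->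
    (forall r, (r <= t)%N -> I (f r)) -> echelon D f -> D 0 = 1 ->
    leads_divisible D I ->
  I = ideal_gen (f @` [set r | (r <= t)%N]).
Proof.
move=> iI If ech D01 div; apply/seteqP; split; last first.
  by apply: ideal_gen_sub => // _ [r /= rt <-]; apply: If.
have gf r : (r <= t)%N -> ideal_gen (f @` [set r | (r <= t)%N]) (f r).
  by move=> rt; apply: sub_ideal_gen; exists r.
have [sz lc] := ech 0%N isT; rewrite subn0 D01 in lc sz.
have szf0 : size (f 0) = t.+1.
  apply/eqP; rewrite eqn_leq sz /= ltnNge; apply/negP => /leq_sizeP h.
  by move: lc; rewrite h // => /eqP; rewrite eq_sym oner_eq0.
have mon0 : f 0 \is monic by rewrite monicE lead_coefE szf0 lc.
move=> g Ig; rewrite (Pdiv.RingMonic.rdivp_eq mon0 g).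
have [|||s ->] := echelon_span (c := 0) (g := Pdiv.Ring.rmodp g (f 0)) iI If ech div => //.
- rewrite (_ : Pdiv.Ring.rmodp _ _ = g - Pdiv.Ring.rdivp g (f 0) * f 0).
    by apply: idealB => //; apply: idealM => //; apply: If.
  by rewrite {2}(Pdiv.RingMonic.rdivp_eq mon0 g) addrC addKr.
- by rewrite subn0 -szf0 ltnW // Pdiv.Ring.ltn_rmodp // monic_neq0.
have iG := ideal_gen_ideal (f @` [set r | (r <= t)%N]).
apply: (idealD iG); first by apply: (idealM iG); apply: gf.
rewrite big_nat_cond; apply: (ideal_sum iG) => r; rewrite andbT => /andP[_ rt].
by apply: (idealZ iG); apply: gf.
Qed.

(** Uniqueness of the normalized column. The difference g - g' has x-degree
    below t - c, hence equals a combination of the f_r with r > c and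
    coefficients s_r; freeness gives a s_r = n'_r - n_r, and comparing degrees
    forces s_r = 0. *)
Lemma division_unique D f I : is_ideal I ->
    (forall r, (r <= t)%N -> I (f r)) -> echelon D f -> leads_divisible D I ->
    (forall r, (r <= t)%N -> D r != 0) ->
  forall c (a : {poly k}) (g g' : biv k) (n n' : nat -> {poly k}),
    (c <= t)%N -> I g -> I g' -> (size g <= (t - c).+1)%N ->
    (size g' <= (t - c).+1)%N -> g`_(t - c) = g'`_(t - c) ->
    (forall r, (c < r <= t)%N -> (size (n r) < size a)%N) ->
    (forall r, (c < r <= t)%N -> (size (n' r) < size a)%N) ->
    a *: g + \sum_(c.+1 <= r < t.+1) n r *: f r =
    a *: g' + \sum_(c.+1 <= r < t.+1) n' r *: f r ->
  g = g' /\ forall r, (c < r <= t)%N -> n r = n' r.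
Proof.
move=> iI If ech div Dn0 c a g g' n n' ct Ig Ig' sg sg' gg' sn sn' E.
have [|||s Hs] := echelon_span (c := c.+1) (g := g - g') iI If ech div => //.
- exact: idealB.
- apply/leq_sizeP => j; rewrite coefB subSS leq_eqVlt => /orP[/eqP <-|tj].
    by rewrite gg' subrr.
  by rewrite (leq_sizeP _ _ sg) // (leq_sizeP _ _ sg') // subrr.
have E0 : \sum_(c.+1 <= r < t.+1) (a * s r + n r - n' r) *: f r = 0.
  under eq_bigr do rewrite scalerBl scalerDl -scalerA.
  rewrite sumrB big_split /= -scaler_sumr -Hs scalerBr.
  by apply/eqP; rewrite subr_eq0 addrAC E addrAC addrN add0r.
have E1 r : (c < r <= t)%N -> s r = 0 /\ n r = n' r.
  move=> crt; have /eqP := echelon_free ech Dn0 E0 crt.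
  have s0 : s r = 0; last by rewrite s0 mulr0 add0r subr_eq0 => /eqP.
  apply/eqP; apply: contraT => sn0.
  have an0 : a != 0 by rewrite -size_poly_gt0; have := sn r crt; lia.
  have : a * s r = n' r - n r.
    have /eqP := echelon_free ech Dn0 E0 crt.
    by rewrite -addrA addr_eq0 opprB => /eqP.
  move=> asE; have : (size (a * s r)%R < size a)%N.
    by rewrite asE (leq_ltn_trans (size_polyD _ _)) // gtn_max size_polyN sn ?sn'.
  rewrite size_mul // -(prednK (n := size (s r))) ?size_poly_gt0 // addnS /=.
  by rewrite ltnNge leq_addr.
split=> [|r crt]; last by case: (E1 r crt).
apply/eqP; rewrite -subr_eq0 Hs big_nat_cond big1 // => r.
by rewrite andbT => crt; rewrite (E1 r crt).1 scale0r.
Qed.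

End Echelon.

(** * Normalized relations *)

Section Resolution.
Context {k : fieldType}.
Variables (t : nat) (m : nat -> nat).
Implicit Types (b : nat -> nat -> {poly k}) (f : nat -> biv k).
Implicit Types (D : nat -> {poly k}) (I : set (biv k)).

(** The entries of M_0(E) + N on and below the diagonal, for N in T_0(E), with
    the terms -x of the subdiagonal removed. *)
Definition hb_shape b : Prop := forall c, (c < t)%N ->
  [/\ b c c \is monic, size (b c c) = (m c.+1 - m c).+1
    & forall r, (c < r <= t)%N -> (size (b r c) <= m c.+1 - m c)%N].

Definition diag_prod b n : {poly k} := \prod_(c < n) b c c.

(** The c-th equation says that column c of the Hilbert-Burch matrix is a
    syzygy of f; its term in x stands on the left-hand side. *)
Definition resolves b f : Prop := f t = (diag_prod b t)%:P /\
  forall c, (c < t)%N -> 'X * f c.+1 = \sum_(c <= r < t.+1) b r c *: f r.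

Definition stair_lead D : Prop :=
  forall r, (r <= t)%N -> D r \is monic /\ size (D r) = (m r).+1.

Definition staircase I : Prop :=
  forall i j, lead_expo I i j <-> (m (t - i) <= j)%N.

Lemma diag_prodS b n : diag_prod b n.+1 = diag_prod b n * b n n.
Proof. by rewrite /diag_prod big_ord_recr. Qed.

Lemma diag_prod0 b : diag_prod b 0 = 1.
Proof. by rewrite /diag_prod big_ord0. Qed.

Lemma stair_lead_neq0 D r : stair_lead D -> (r <= t)%N -> D r != 0.
Proof. by move=> lD rt; apply: monic_neq0; case: (lD r rt). Qed.

Lemma resolves_step b f c : resolves b f -> (c < t)%N ->
  b c c *: f c = 'X * f c.+1 - \sum_(c.+1 <= r < t.+1) b r c *: f r.
Proof.
by move=> [_ rel] ct; rewrite rel // big_ltn ?ltnS 1?ltnW // addrK.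
Qed.

(** The column relations express f_c through f_r with r > c, so statements
    about the family are proved from r = t downwards. *)
Lemma downward_ind (P : nat -> Prop) :
  P t -> (forall c, (c < t)%N -> (forall r, (c < r <= t)%N -> P r) -> P c) ->
  forall r, (r <= t)%N -> P r.
Proof.
move=> Pt Pstep r; have [n] := ubnP (t - r); elim: n r => // n IH r lt rt.
have [->//|ne] := eqVneq r t.
by apply: Pstep => [|i /andP[ri it]]; [|apply: IH => //]; lia.
Qed.

(** Comparing coefficients of x^(t - c) in the c-th relation gives
    b_(c,c) lc(f_c) = lc(f_(c+1)) = D_(c+1) = D_c b_(c,c), and b_(c,c) cancels. *)
Lemma resolves_echelon b f : hb_shape b -> resolves b f ->
  echelon t (diag_prod b) f.
Proof.
move=> sb res.
suff H r : (r <= t)%N -> forall j, (t - r <= j)%N ->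
    (f r)`_j = if j == (t - r)%N then diag_prod b r else 0.
  move=> r rt; split; last by rewrite H // eqxx.
  by apply/leq_sizeP => j tj; rewrite (H r rt j (ltnW tj)) gtn_eqF.
move: r; apply: downward_ind => [j _|c ct IH j tj].
  by rewrite res.1 coefC subnn.
have [bm _ _] := sb c ct; apply: (mulfI (monic_neq0 bm)).
rewrite -coefZ (resolves_step res ct) coefB coef_sum big_nat_cond big1 => [|r].
  rewrite subr0 mulrC coefMX; case: j tj => [|j tj]; first by lia.
  rewrite /= IH; try lia.
  have -> : (j.+1 == t - c)%N = (j == t - c.+1)%N by lia.
  by case: eqP; rewrite ?mulr0 // diag_prodS mulrC.
rewrite andbT => /andP[cr rt]; rewrite coefZ IH; try lia.
by rewrite gtn_eqF ?mulr0 //; lia.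
Qed.

(** D_(c+1) divides every f_r with r > c, hence b_(c,c) f_c, and
    D_(c+1) = D_c b_(c,c). *)
Lemma resolves_dvdp b f : hb_shape b -> resolves b f ->
  forall r, (r <= t)%N -> forall j, diag_prod b r %| (f r)`_j.
Proof.
move=> sb res; apply: downward_ind => [j|c ct IH j].
  by rewrite res.1 coefC; case: eqP; rewrite ?dvdp0 ?dvdpp.
have [bm _ _] := sb c ct.
rewrite -(@dvdp_mul2l _ (b c c)) ?monic_neq0 // -coefZ (resolves_step res ct).
rewrite mulrC -diag_prodS coefB dvdp_sub //.
  by rewrite mulrC coefMX; case: eqP; rewrite ?dvdp0 // => _; apply: IH; lia.
rewrite coef_sum big_nat_cond; elim/big_ind: _ => [|x y|r]; first exact: dvdp0.
  exact: dvdp_add.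
rewrite andbT => /andP[cr rt]; rewrite coefZ dvdp_mull //.
apply: dvdp_trans (IH _ _ _); last by lia.
elim: r cr rt => // r IHr; rewrite leq_eqVlt => /orP[/eqP <-//|cr] rt.
by rewrite (diag_prodS b r) dvdp_mulr // IHr //; lia.
Qed.

(** Each f_c is recovered by cancelling b_(c,c); in particular the signed
    minors can be identified without expanding them. *)
Lemma resolves_unique b f f' : hb_shape b -> resolves b f -> resolves b f' ->
  forall r, (r <= t)%N -> f r = f' r.
Proof.
move=> sb res res'; apply: downward_ind => [|c ct IH]; first by rewrite res.1 res'.1.
have [bm _ _] := sb c ct; have bn0 : (b c c)%:P != 0 :> biv k.
  by rewrite polyC_eq0 monic_neq0.
apply: (mulfI bn0); rewrite !mul_polyC (resolves_step res) // (resolves_step res') //.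
rewrite IH ?ltnSn //; congr (_ - _); apply: eq_big_nat => r /andP[cr rt].
by rewrite IH // cr.
Qed.

(** The relations rewrite x f_r, for r > 0, as a combination over k[y], so only
    f_0 needs coefficients involving x. *)
Lemma resolves_ideal_gen b f : hb_shape b -> resolves b f ->
  ideal_gen (f @` [set r | (r <= t)%N]) `<=`
  [set g | exists p s, g = p * f 0 + \sum_(1 <= r < t.+1) s r *: f r].
Proof.
move=> sb res; set J := (X in _ `<=` X).
have J0 : J 0.
  exists 0, (fun=> 0); rewrite mul0r add0r big1 // => r _; exact: scale0r.
have JD g h : J g -> J h -> J (g + h).
  move=> [p [s ->]] [p' [s' ->]]; exists (p + p'), (fun r => s r + s' r).
  rewrite mulrDl addrACA -big_split; congr (_ + _).
  by apply: eq_bigr => r _; rewrite scalerDl.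
have JZ (c : {poly k}) g : J g -> J (c *: g).
  move=> [p [s ->]]; exists (c *: p), (fun r => c * s r).
  rewrite scalerDr scalerAl scaler_sumr; congr (_ + _).
  by apply: eq_bigr => r _; rewrite scalerA.
have Jsum i j (F : nat -> biv k) : (forall r, (i <= r < j)%N -> J (F r)) ->
    J (\sum_(i <= r < j) F r).
  move=> JF; rewrite big_nat_cond; elim/big_ind: _ => // r.
  by rewrite andbT => /JF.
have Jf r : (r <= t)%N -> J (f r).
  case: r => [_|r rt].
    exists 1, (fun=> 0); rewrite mul1r big1 ?addr0 // => r _; exact: scale0r.
  exists 0, (fun i => (i == r.+1)%:R); rewrite mul0r add0r.
  rewrite (bigD1_seq r.+1) ?mem_index_iota ?iota_uniq //= eqxx scale1r.
  by rewrite big1 ?addr0 // => i /negPf ->; rewrite scale0r.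
apply: ideal_gen_sub => [|_ [r /= rt <-]]; last exact: Jf.
apply: is_idealXZ => // g [p [s ->]]; rewrite mulrDr; apply: JD.
  exists ('X * p), (fun=> 0); rewrite mulrA big1 ?addr0 // => r _; exact: scale0r.
rewrite mulr_sumr; apply: (Jsum _ _ _) => -[//|r] /andP[_ rt].
rewrite -scalerAr; apply: (JZ _ _); rewrite res.2; last by lia.
by apply: Jsum => i /andP[_ it]; apply: JZ; apply: Jf; lia.
Qed.

(** Take f_r in I with leading exponent (t - r, m_r) and leading coefficient
    made monic. If D_r did not divide some coefficient of x^(t - r), the
    remainder would be the leading coefficient of an element of I whose
    exponent lies strictly below the staircase. *)
Lemma echelon_of_staircase I : is_ideal I -> staircase I ->
  exists D f, [/\ forall r, (r <= t)%N -> I (f r), echelon t D f, stair_lead D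
                & leads_divisible t D I].
Proof.
move=> iI st.
have ex r : exists g, (r <= t)%N ->
    [/\ I g, size g = (t - r).+1, lead_coef g \is monic
      & size (lead_coef g) = (m r).+1].
  have [rt|] := leqP r t; last by exists 0.
  have [|g [Ig sg sl]] := (st (t - r) (m r))%N.2; first by rewrite subKn.
  pose a := lead_coef (lead_coef g).
  have an0 : a != 0 by rewrite lead_coef_eq0 -size_poly_eq0 sl.
  have aVn0 : (a^-1)%:P != 0 :> {poly k} by rewrite polyC_eq0 invr_eq0.
  exists ((a^-1)%:P *: g) => _; split.
  - exact: idealZ.
  - by rewrite size_scale.
  - by rewrite lead_coefZ monicE lead_coefM lead_coefC mulVf.
  - by rewrite lead_coefZ mul_polyC size_scale ?invr_eq0.
have [f Hf] := choice ex; exists (fun r => lead_coef (f r)), f; split.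
- by move=> r /Hf[].
- by move=> r /Hf[_ sz _ _]; rewrite lead_coefE sz.
- by move=> r /Hf[].
move=> r g rt Ig sg; have [If sf lm sl] := Hf r rt.
rewrite /dvdp; apply: contraT => rem0; set D := lead_coef (f r) in lm sl rem0.
(* h has the remainder as its leading coefficient in x. *)
pose h := g - (g`_(t - r) %/ D) *: f r.
have hc : h`_(t - r) = g`_(t - r) %% D.
  have frD : (f r)`_(t - r) = D by rewrite /D lead_coefE sf.
  by rewrite coefB coefZ frD {1}(divp_eq g`_(t - r) D) addrC addKr.
have sh : size h = (t - r).+1.
  apply/eqP; rewrite eqn_leq; apply/andP; split; last first.
    by rewrite ltnNge; apply: contraNN rem0 => /leq_sizeP h0; rewrite -hc h0.
  apply/leq_sizeP => j tj; rewrite coefB coefZ (leq_sizeP _ _ sg j tj).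
  by rewrite (nth_default 0 (s := f r)) ?sf // mulr0 subrr.
have : lead_expo I (t - r) (size (g`_(t - r) %% D)).-1.
  exists h; split=> //; first by apply: idealB => //; apply: idealZ.
  by rewrite lead_coefE sh /= hc prednK // size_poly_gt0.
have lt : (size (g`_(t - r) %% D)%R < (m r).+1)%N.
  by rewrite -sl ltn_modp monic_neq0.
move/st; rewrite subKn // -ltnS prednK ?size_poly_gt0 //.
by rewrite ltnNge -ltnS lt.
Qed.

Hypotheses (m0 : m 0 = 0%N) (m_homo : {homo m : i j / (i <= j)%N}).

Lemma diag_prod_lead b : hb_shape b -> stair_lead (diag_prod b).
Proof.
move=> sb; elim=> [|r IH] rt; first by rewrite diag_prod0 monic1 size_poly1 m0.
have [mon sz] := IH (ltnW rt); have [bm bs _] := sb r rt.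
rewrite diag_prodS rpredM // size_Mmonic ?monic_neq0 // sz bs; split=> //.
by rewrite addnS /= addSn subnKC ?m_homo.
Qed.

(** For r > 0, an element of x-degree at most t - r < t cannot involve f_0, and
    triangular elimination then discards the f_i with i < r; only f_r contributes to the
    coefficient of x^(t - r). *)
Lemma resolves_leads_divisible b f : hb_shape b -> resolves b f ->
  leads_divisible t (diag_prod b) (ideal_gen (f @` [set r | (r <= t)%N])).
Proof.
move=> sb res; have ech := resolves_echelon sb res.
have lead := diag_prod_lead sb.
have Dn0 r : (r <= t)%N -> diag_prod b r != 0 by apply: stair_lead_neq0.
have [sz0 lc0] := ech 0%N isT; rewrite subn0 diag_prod0 in sz0 lc0.
have szf0 : size (f 0) = t.+1.
  apply/eqP; rewrite eqn_leq sz0 /= ltnNge; apply/negP => /leq_sizeP h.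
  by move: lc0; rewrite h // => /eqP; rewrite eq_sym oner_eq0.
have mon0 : f 0 \is monic by rewrite monicE lead_coefE szf0 lc0.
move=> r g rt /(resolves_ideal_gen sb res)[p [s gE]] sg.
have [->|r0] := posnP r; first by rewrite diag_prod0 dvd1p.
(* As f 0 is monic of x-degree t, a nonzero multiple of it cannot be offset by
   the terms with r >= 1. *)
have p0 : p = 0.
  apply/eqP; apply: contraT => pn0.
  have : (size (p * f 0)%R <= t)%N.
    have -> : p * f 0 = g - \sum_(1 <= r < t.+1) s r *: f r by rewrite gE addrK.
    apply/leq_sizeP => j tj; rewrite coefB (leq_sizeP _ _ sg); last by lia.
    rewrite coef_sum big_nat_cond big1 ?subrr // => i; rewrite andbT => it.
    by rewrite coefZ (leq_sizeP _ _ (ech i _).1) ?mulr0 //; lia.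
  by rewrite size_Mmonic // szf0 addnS /= -{2}(add0n t) leq_add2r leqn0 size_poly_eq0 (negPf pn0).
pose s' i := if i == 0%N then 0 else s i.
have {gE p0}gE : g = \sum_(0 <= i < t.+1) s' i *: f i.
  rewrite gE p0 mul0r add0r [RHS]big_ltn // /s' eqxx scale0r add0r.
  by apply: eq_big_nat => i /andP[i0 _]; rewrite gtn_eqF.
have s'0 : forall i, (i < r)%N -> s' i = 0.
  apply: (echelon_coef0 ech Dn0) => [|i ir]; first by lia.
  by rewrite -gE (leq_sizeP _ _ sg) //; lia.
rewrite gE coef_sum big_nat_cond; elim/big_ind: _ => [|x y|i]; first exact: dvdp0.
  exact: dvdp_add.
rewrite andbT => /andP[_ it]; rewrite coefZ.
have [ir|ri|->] := ltngtP i r.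
- by rewrite s'0 // mul0r dvdp0.
- by rewrite (leq_sizeP _ _ (ech i _).1) ?mulr0 ?dvdp0 //; lia.
- by rewrite (ech r rt).2 dvdp_mull.
Qed.

Lemma staircase_of_echelon D f I : is_ideal I ->
    (forall r, (r <= t)%N -> I (f r)) -> echelon t D f -> stair_lead D ->
    leads_divisible t D I ->
  staircase I.
Proof.
move=> iI If ech lead div i j; split.
  move=> [g [Ig sg sl]]; have [it|ti] := leqP i t; last first.
    by rewrite (_ : t - i = 0)%N ?m0 //; lia.
  have gi : lead_coef g = g`_i by rewrite lead_coefE sg.
  have := div (t - i)%N g (leq_subr _ _) Ig; rewrite subKn // sg leqnn => /(_ isT).
  rewrite -gi => /dvdp_leq; rewrite -size_poly_eq0 sl => /(_ isT).
  by rewrite (lead _ (leq_subr _ _)).2.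
move=> mj; set r := (t - i)%N in mj; have rt : (r <= t)%N by apply: leq_subr.
have [sz lc] := ech r rt; have [Dm Ds] := lead r rt.
have szf : size (f r) = (t - r).+1.
  apply/eqP; rewrite eqn_leq sz /= ltnNge; apply/negP => /leq_sizeP h.
  by move: (monic_neq0 Dm); rewrite -lc h ?eqxx.
have lf : lead_coef (f r) = D r by rewrite lead_coefE szf.
have sXf : size ('X^(j - m r) *: f r) = (t - r).+1.
  by rewrite size_scale // -size_poly_eq0 size_polyXn.
exists ('X^(i - (t - r)) * ('X^(j - m r) *: f r)); split.
- by apply: idealM => //; apply: idealZ => //; apply: If.
- by rewrite [_ * _]mulrC size_mulXn ?sXf -?size_poly_eq0 ?sXf //; lia.
- rewrite lead_coefM lead_coefXn mul1r lead_coefZ lf mulrC size_mulXn ?monic_neq0 //.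
  by rewrite Ds; lia.
Qed.

(** Descending construction: at stage n the relations hold for the last n
    columns. The element x f_(c+1) - a_c f_c has x-degree below t - c, hence is
    sum_(r > c) s_r f_r; dividing s_r by a_c moves the quotients into f_c and
    leaves the remainders as the entries of column c. *)
Lemma exists_resolution D g I : is_ideal I ->
    (forall r, (r <= t)%N -> I (g r)) -> echelon t D g -> stair_lead D ->
    leads_divisible t D I ->
  exists b f, [/\ hb_shape b, resolves b f, forall r, (r <= t)%N -> I (f r)
                & forall r, (r <= t)%N -> diag_prod b r = D r].
Proof.
move=> iI Ig echg lead div.
have Ddvd c : (c < t)%N -> D c %| D c.+1.
  move=> ct; have [sz <-] := echg c.+1 ct.
  have := div c ('X * g c.+1) (ltnW ct); rewrite mulrC coefMX.
  have -> : (t - c == 0)%N = false by lia.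
  rewrite -subnS; apply; first by rewrite mulrC; apply: idealM => //; apply: Ig.
  apply: leq_trans (size_polyMleq _ _) _; rewrite size_polyX addn2 /=.
  by rewrite -subSn // subSS in sz *.
pose a c : {poly k} := D c.+1 %/ D c.
have aD c : (c < t)%N -> D c.+1 = D c * a c by move=> /Ddvd; rewrite mulrC => /divpK.
have am c : (c < t)%N -> a c \is monic /\ size (a c) = (m c.+1 - m c).+1.
  move=> ct; have [m1 s1] := lead c (ltnW ct); have [m2 s2] := lead c.+1 ct.
  have ma : a c \is monic by rewrite -(monicMl _ m1) -aD.
  split=> //; move: s2; rewrite aD // size_Mmonic ?monic_neq0 // s1 addSn /= => s2.
  have : size (a c) != 0%N by rewrite size_poly_eq0 monic_neq0.
  by have := m_homo (leqnSn c); lia.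
have stage n : (n <= t)%N -> exists b f,
    [/\ forall r, (r <= t)%N -> I (f r), echelon t D f
      & forall c, (t - n <= c < t)%N -> [/\ b c c = a c,
          forall r, (c < r <= t)%N -> (size (b r c) < size (a c))%N
        & 'X * f c.+1 = \sum_(c <= r < t.+1) b r c *: f r]].
  elim: n => [_|n IH nt].
    by exists (fun _ _ => 0), g; split => // c; lia.
  have [b [f [If ech rel]]] := IH (ltnW nt).
  pose c := (t - n.+1)%N; have ct : (c < t)%N by rewrite /c; lia.
  have [szc lcc] := ech c (ltnW ct); have [szc1 lcc1] := ech c.+1 ct.
  have [|||s Hs] := echelon_span (c := c.+1) (g := 'X * f c.+1 - a c *: f c)
      iI If ech div.
  - by apply: idealB => //; [apply: idealM|apply: idealZ] => //; apply: If => //; lia.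
  - by lia.
  - apply/leq_sizeP => j cj; rewrite coefB coefZ mulrC coefMX.
    have -> : (j == 0)%N = false by lia.
    have [jc|jc] := eqVneq j (t - c)%N.
      rewrite jc lcc (_ : (t - c).-1 = (t - c.+1)%N) ?lcc1; last by lia.
      by rewrite aD // mulrC subrr.
    rewrite (leq_sizeP _ _ szc) ?(leq_sizeP _ _ szc1); try lia.
    by rewrite mulr0 subrr.
  have an0 : a c != 0 by rewrite monic_neq0 //; case: (am c ct).
  (* Only f c changes: the columns already treated involve f r for r > c. *)
  pose f' r := if r == c
    then f c + \sum_(c.+1 <= i < t.+1) (s i %/ a c) *: f i else f r.
  pose b' r c' := if c' == c then if r == c then a c else s r %% a c else b r c'.
  have f'E r : (c < r)%N -> f' r = f r by move=> cr; rewrite /f' gtn_eqF.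
  exists b', f'; split.
  - move=> r rt; rewrite /f'; case: eqP => [_|_]; last exact: If.
    apply: idealD => //; first by apply: If; lia.
    rewrite big_nat_cond; apply: ideal_sum => // i; rewrite andbT => /andP[_ it].
    by apply: idealZ => //; apply: If.
  - move=> r rt; rewrite /f'; case: eqP => [->|_]; last exact: ech.
    have sum0 j : (t - c <= j)%N ->
        (\sum_(c.+1 <= i < t.+1) (s i %/ a c) *: f i)`_j = 0.
      move=> tj; rewrite coef_sum big_nat_cond big1 // => i.
      rewrite andbT => /andP[ci it]; rewrite coefZ.
      by rewrite (leq_sizeP _ _ (ech i it).1) ?mulr0 //; lia.
    split; last by rewrite coefD sum0 // addr0.
    apply/leq_sizeP => j tj; rewrite coefD sum0 1?ltnW // addr0.
    exact: (leq_sizeP _ _ szc).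
  move=> c' /andP[c'1 c't]; rewrite /b'; case: eqP => [->|ne].
    split=> // [r /andP[cr rt]|].
      by rewrite gtn_eqF // ltn_modp.
    rewrite big_ltn ?ltnS 1?ltnW // eqxx f'E // /f' eqxx scalerDr.
    rewrite scaler_sumr -addrA.
    rewrite [X in _ + (_ + X)](_ : _ = \sum_(c.+1 <= r < t.+1) (s r %% a c) *: f r).
      rewrite -big_split /= [X in _ + X](_ : _ = \sum_(c.+1 <= r < t.+1) s r *: f r).
        by rewrite -Hs addrC subrK.
      by apply: eq_bigr => r _; rewrite scalerA -scalerDl mulrC -divp_eq.
    by apply: eq_big_nat => r /andP[cr _]; rewrite -/(f' r) f'E // gtn_eqF.
  have [|bc sz rl] := rel c'; first by move: c'1 ne; rewrite /c; lia.
  split=> //; rewrite f'E; last by rewrite /c; lia.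
  rewrite rl; apply: eq_big_nat => r /andP[cr _].
  by rewrite f'E //; apply: leq_trans cr; rewrite /c; lia.
have [b [f [If ech]]] := stage t (leqnn t); rewrite subnn => rel.
(* The diagonal quotients telescope, starting from D 0 = 1. *)
have Db r : (r <= t)%N -> diag_prod b r = D r.
  elim: r => [_|r IH rt].
    rewrite diag_prod0; have [_ s0] := lead 0%N isT.
    have /size_poly1P[x x0 Dx] : size (D 0) == 1%N by rewrite s0 m0.
    have [mon _] := lead 0%N isT; move: mon; rewrite monicE Dx lead_coefC.
    by move/eqP->.
  by rewrite diag_prodS (IH (ltnW rt)) aD //; case: (rel r rt) => ->.
exists b, f; split=> //.
- move=> c ct; have [bc sz _] := rel c ct; have [ma sa] := am c ct.
  by rewrite bc; split=> // r crt; rewrite -ltnS -sa sz.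
split=> [|c ct]; last by case: (rel c ct).
have [sz lc] := ech t (leqnn t); rewrite subnn in sz lc.
by rewrite Db // (size1_polyC sz) lc.
Qed.

(** The polynomials D_r depend only on I, hence so does the diagonal, and
    [division_unique] determines the columns one after another. *)
Lemma resolution_unique b b' f f' I : is_ideal I ->
    hb_shape b -> hb_shape b' -> resolves b f -> resolves b' f' ->
    (forall r, (r <= t)%N -> I (f r)) -> (forall r, (r <= t)%N -> I (f' r)) ->
    leads_divisible t (diag_prod b) I -> leads_divisible t (diag_prod b') I ->
  forall r c, (c < t)%N -> (c <= r <= t)%N -> b r c = b' r c.
Proof.
move=> iI sb sb' res res' If If' div div'.
have ech := resolves_echelon sb res; have ech' := resolves_echelon sb' res'.
have ld := diag_prod_lead sb; have ld' := diag_prod_lead sb'.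
have DD r : (r <= t)%N -> diag_prod b r = diag_prod b' r.
  move=> rt; have [sz lc] := ech r rt; have [sz' lc'] := ech' r rt.
  have [mon _] := ld r rt; have [mon' _] := ld' r rt.
  apply/eqP; rewrite -(eqp_monic mon mon') /eqp; apply/andP; split.
    by rewrite -lc'; apply: div => //; apply: If'.
  by rewrite -lc; apply: div' => //; apply: If.
have bb c : (c < t)%N -> b c c = b' c c.
  move=> ct; apply: (mulfI (stair_lead_neq0 ld (ltnW ct))).
  by rewrite -diag_prodS !DD // 1?ltnW // diag_prodS.
have step c : (c < t)%N -> (forall r, (c < r <= t)%N -> f r = f' r) ->
    f c = f' c /\ forall r, (c < r <= t)%N -> b r c = b' r c.
  move=> ct ff; have [sz lc] := ech c (ltnW ct); have [sz' lc'] := ech' c (ltnW ct).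
  have [_ s1 s2] := sb c ct; have [_ s1' s2'] := sb' c ct.
  have Dn0 i : (i <= t)%N -> diag_prod b i != 0 by apply: stair_lead_neq0.
  apply: (division_unique iI If ech div Dn0 (a := b c c) (n := fun r => b r c)
    (n' := fun r => b' r c)) => //.
  - exact: ltnW.
  - by apply: If; apply: ltnW.
  - by apply: If'; apply: ltnW.
  - by rewrite lc lc' DD // ltnW.
  - by move=> r crt; rewrite s1 ltnS s2.
  - by move=> r crt; rewrite s1 ltnS s2'.
  have sumE : \sum_(c.+1 <= r < t.+1) b' r c *: f r =
      \sum_(c.+1 <= r < t.+1) b' r c *: f' r.
    by apply: eq_big_nat => r crt; rewrite ff.
  by rewrite sumE (resolves_step res) // bb // (resolves_step res') // !subrK ff ?ltnSn.
have ff : forall r, (r <= t)%N -> f r = f' r.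
  apply: downward_ind => [|c ct IH]; last by case: (step c ct IH).
  by rewrite res.1 res'.1 DD.
move=> r c ct /andP[]; rewrite leq_eqVlt => /orP[/eqP <- _|cr rt]; first exact: bb.
by apply: (step c ct _).2; rewrite ?cr // => i /andP[_]; apply: ff.
Qed.

End Resolution.

(** * Maximal minors and the bijection from T_0 to V_0 *)

Section Minors.

(** The sum is the expansion, along its first column, of the determinant of A
    with column c repeated in front. *)
Lemma maximal_minors_relation (R : comNzRingType) t (A : 'M[R]_(t.+1, t))
    (c : 'I_t) :
  \sum_(r < t.+1) (-1) ^+ r * \det (row' r A) * A r c = 0.
Proof.
(* Column 0 of C is column c of A, and the other columns are those of A. *)
pose C : 'M[R]_t.+1 := \matrix_(i, j)
  if unlift ord0 j is Some j' then A i j' else A i c.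
have C0 : \det C = 0.
  rewrite -det_tr; apply: (determinant_alternate (neq_lift ord0 c)) => i.
  by rewrite !mxE unlift_none liftK.
rewrite -[RHS]C0 (expand_det_col C ord0); apply: eq_bigr => r _.
rewrite mxE unlift_none mulrC /cofactor addn0; congr (_ * (_ * \det _)).
by apply/matrixP => i j; rewrite !mxE liftK.
Qed.

Context {k : fieldType} (E : set (biv k)).
Implicit Types (N : 'M[{poly k}]_((tE E).+1, tE E)).
Local Notation t := (tE E).
Local Notation m := (mE E).

(** Indexing by nat avoids casts between the row and column ordinals. *)
Definition hb_entry N (r c : nat) : {poly k} :=
  (if (insub r, insub c) is (Some i, Some j) then N i j else 0) +
  (if r == c then 'X^(dE E c.+1) else 0).

Lemma hb_entryE N (r : 'I_t.+1) (c : 'I_t) :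
  hb_entry N r c = N r c + (if r == c :> nat then 'X^(dE E c.+1) else 0).
Proof. by rewrite /hb_entry !valK. Qed.

Lemma T0_hb_shape N : T0 E N -> hb_shape t m (hb_entry N).
Proof.
move=> TN c ct; pose j := Ordinal ct.
have ct1 : (c < t.+1)%N by apply: ltnW.
have [_ /(_ (leqnn _)) sz] := TN (Ordinal ct1) j.
have -> : hb_entry N c c = 'X^(dE E c.+1) + N (Ordinal ct1) j.
  by rewrite (hb_entryE N (Ordinal ct1) j) eqxx addrC.
have lt : (size (N (Ordinal ct1) j) < size ('X^(dE E c.+1) : {poly k}))%N.
  by rewrite size_polyXn.
split.
- by rewrite monicE lead_coefDl // lead_coefXn.
- by rewrite size_polyDl // size_polyXn.
move=> r /andP[cr rt]; rewrite (hb_entryE N (Ordinal (rt : r < t.+1)%N) j) /=.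
by rewrite gtn_eqF // addr0; case: (TN (Ordinal (rt : r < t.+1)%N) j) => _; apply; apply: ltnW.
Qed.

Lemma T0_of_hb_shape b : hb_shape t m b -> exists N, T0 E N /\
  forall r c, (c < t)%N -> (c <= r <= t)%N -> hb_entry N r c = b r c.
Proof.
move=> sb; pose N : 'M[{poly k}]_(t.+1, t) := \matrix_(r, c)
  if (c <= r)%N then b r c - (if r == c :> nat then 'X^(dE E c.+1) else 0) else 0.
exists N; split => [r c|r c ct /andP[cr rt]].
  rewrite mxE; split; first by rewrite ltnNge => /negPf ->.
  move=> cr; rewrite cr; have [mon sz le] := sb c (ltn_ord c).
  case: eqP => [rc|ne].
    rewrite rc; apply/leq_sizeP => j; rewrite leq_eqVlt coefB => /orP[/eqP <-|dj].
      move: mon; rewrite monicE lead_coefE sz => /eqP ->.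
      by rewrite coefXn eqxx subrr.
    by rewrite nth_default ?sz // coefXn gtn_eqF // subrr.
  by rewrite subr0 le //; have := ltn_ord r; lia.
by rewrite (hb_entryE N (Ordinal (rt : r < t.+1)%N) (Ordinal ct)) mxE /= cr subrK.
Qed.

Lemma T0_hb_inj N N' : T0 E N -> T0 E N' ->
  (forall r c, (c < t)%N -> (c <= r <= t)%N ->
     hb_entry N r c = hb_entry N' r c) ->
  N = N'.
Proof.
move=> TN TN' H; apply/matrixP => r c; have [rc|cr] := ltnP r c.
  by rewrite (TN r c).1 ?(TN' r c).1.
have := H r c (ltn_ord c); rewrite cr -ltnS ltn_ord => /(_ isT).
by rewrite !hb_entryE => /addIr.
Qed.

(** The sign makes the leading coefficient in x equal to D_r, rather than
    to its opposite. *)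
Definition signed_minor N (r : nat) : biv k :=
  (-1) ^+ (t + r) * \det (row' (inord r) (M0 E + map_mx polyC N)).

Lemma hb_matrixE N (r : 'I_t.+1) (c : 'I_t) : (M0 E + map_mx polyC N) r c =
  (hb_entry N r c)%:P - (if r == c.+1 :> nat then 'X else 0).
Proof.
rewrite !mxE hb_entryE; case: eqP => [->|ne].
  by rewrite ltn_eqF // subr0 polyCD addrC rmorphXn.
by rewrite addr0; case: eqP => _; rewrite ?subr0 ?add0r // addrC.
Qed.

Lemma T0_hb_upper N (r : 'I_t.+1) (c : 'I_t) :
  T0 E N -> (r < c)%N -> hb_entry N r c = 0.
Proof. by move=> TN rc; rewrite hb_entryE (TN r c).1 // ltn_eqF // addr0. Qed.

(** Deleting the last row leaves a triangular matrix, whose determinant is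
    the product of the diagonal. *)
Lemma signed_minor_resolves N : T0 E N -> resolves t (hb_entry N) (signed_minor N).
Proof.
move=> TN; split=> [|c ct].
  rewrite /signed_minor -signr_odd oddD addbb mul1r (_ : inord t = ord_max); last first.
    by apply: val_inj; rewrite /= inordK.
  rewrite det_trig.
    rewrite /diag_prod rmorph_prod /=; apply: eq_bigr => i _.
    by rewrite mxE hb_matrixE lift_max ltn_eqF // subr0.
  apply/is_trig_mxP => i j ij; rewrite mxE hb_matrixE T0_hb_upper ?lift_max //.
  by rewrite ltn_eqF ?subr0 // ltnW.
have := maximal_minors_relation (M0 E + map_mx polyC N) (Ordinal ct).
move/(congr1 (fun x => (-1) ^+ t * x)); rewrite mulr0 mulr_sumr.
rewrite (eq_bigr (fun r : 'I_t.+1 => hb_entry N r c *: signed_minor N r -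
    (if r == c.+1 :> nat then 'X else 0) * signed_minor N r)) => [|r _]; last first.
  rewrite hb_matrixE /= -mul_polyC -mulrBl /signed_minor inord_val exprD.
  by rewrite [RHS]mulrC !mulrA.
rewrite sumrB => /eqP; rewrite subr_eq0 => /eqP rel.
transitivity (\sum_(r < t.+1) (if r == c.+1 :> nat then 'X else 0) * signed_minor N r).
  rewrite (bigD1 (Ordinal (ct : c.+1 < t.+1)%N)) //= eqxx big1 ?addr0 // => r.
  by rewrite -val_eqE /= => /negPf ->; rewrite mul0r.
rewrite -rel -(big_mkord xpredT (fun r => hb_entry N r c *: signed_minor N r)).
rewrite (big_cat_nat (n := c)) //=; last by lia.
rewrite big_nat_cond big1 ?add0r // => r; rewrite andbT => rc.
have rt : (r < t.+1)%N by lia.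
by rewrite (T0_hb_upper (r := Ordinal rt) (c := Ordinal ct)) ?scale0r.
Qed.

Lemma phi_signed_minor N :
  phi E N = ideal_gen (signed_minor N @` [set r | (r <= t)%N]).
Proof.
apply/seteqP; split; apply: ideal_gen_sub; try exact: ideal_gen_ideal.
  move=> _ [r _ <-].
  rewrite -[\det _](signrMK (t + r)); apply: (idealM (ideal_gen_ideal _)).
  apply: sub_ideal_gen; exists r => /=; first by rewrite -ltnS.
  by rewrite /signed_minor inord_val.
move=> _ [r rt <-]; apply: (idealM (ideal_gen_ideal _)); apply: sub_ideal_gen.
by exists (inord r).
Qed.

End Minors.

Section MainBijection.
Context {k : fieldType} (E : set (biv k)).
Hypotheses (E_monomial : monomial_ideal E) (E_finite : finite_codim E).
Local Notation t := (tE E).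
Local Notation m := (mE E).

Let m0 : m 0 = 0%N := mE0 E_monomial E_finite.
Let m_homo : {homo m : i j / (i <= j)%N} := mE_homo E_monomial E_finite.

Lemma V0_staircase I : V0 E I <-> is_ideal I /\ staircase t m I.
Proof.
split=> -[iI H]; split => //.
  by move=> a b; rewrite ((Lt_idealE iI E_monomial).1 H) mem_monom.
by apply/(Lt_idealE iI E_monomial) => a b; rewrite H mem_monom.
Qed.

Lemma phi_ideal N : is_ideal (phi E N).
Proof. exact: ideal_gen_ideal. Qed.

Lemma signed_minor_mem N r : (r <= t)%N -> phi E N (signed_minor N r).
Proof. by move=> rt; rewrite phi_signed_minor; apply: sub_ideal_gen; exists r. Qed.

Lemma phi_leads_divisible N : T0 E N ->
  leads_divisible t (diag_prod (hb_entry N)) (phi E N).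
Proof.
move=> TN; rewrite phi_signed_minor.
exact: (resolves_leads_divisible m0 m_homo (T0_hb_shape TN) (signed_minor_resolves TN)).
Qed.

Lemma phi_V0 N : T0 E N -> V0 E (phi E N).
Proof.
move=> TN; apply/V0_staircase; split; first exact: phi_ideal.
have sN := T0_hb_shape TN.
have ech := resolves_echelon sN (signed_minor_resolves TN).
apply: (staircase_of_echelon m0 (phi_ideal N) _ ech).
- exact: signed_minor_mem.
- exact: diag_prod_lead.
- exact: phi_leads_divisible.
Qed.

Lemma phi_inj N N' : T0 E N -> T0 E N' -> phi E N = phi E N' -> N = N'.
Proof.
move=> TN TN' eqphi; apply: T0_hb_inj => //.
apply: (resolution_unique m0 m_homo (phi_ideal N) (T0_hb_shape TN)
  (T0_hb_shape TN') (signed_minor_resolves TN) (signed_minor_resolves TN')).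
- exact: signed_minor_mem.
- by rewrite eqphi; apply: signed_minor_mem.
- exact: phi_leads_divisible.
- by rewrite eqphi; apply: phi_leads_divisible.
Qed.

(** The family built from I and the signed minors solve the same relations, so
    they coincide and generate the same ideal. *)
Lemma phi_surj I : V0 E I -> exists2 N, T0 E N & phi E N = I.
Proof.
move=> /V0_staircase[iI st].
have [D [g [Ig ech lead div]]] := echelon_of_staircase iI st.
have [b [f [sb res If Db]]] := exists_resolution m0 m_homo iI Ig ech lead div.
have [N [TN Nb]] := T0_of_hb_shape sb; exists N => //.
have Nb_diag n : (n <= t)%N -> diag_prod (hb_entry N) n = diag_prod b n.
  move=> nt; apply: eq_bigr => i _; have := ltn_ord i.
  by move=> it; rewrite Nb //; lia.
have resN : resolves t (hb_entry N) f.
  split=> [|c ct]; first by rewrite res.1 Nb_diag.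
  by rewrite res.2 //; apply: eq_big_nat => r crt; rewrite Nb.
have sN := T0_hb_shape TN.
have fE := resolves_unique sN resN (signed_minor_resolves TN).
rewrite phi_signed_minor (_ : signed_minor N @` _ = f @` [set r | (r <= t)%N]).
  apply/esym/(echelon_ideal_gen iI If (resolves_echelon sN resN)).
    exact: diag_prod0.
  by move=> r h rt; rewrite Nb_diag // Db //; apply: div.
by apply: eq_imagel => r /= rt; rewrite fE.
Qed.

Lemma set_bij_restrict (cond : 'M[{poly k}]_(t.+1, t) -> Prop)
    (prop : set (biv k) -> Prop) :
    (forall N, T0 E N -> cond N <-> prop (phi E N)) ->
  set_bij [set N | T0 E N /\ cond N] [set I | V0 E I /\ prop I] (phi E).
Proof.
move=> H; split.
- by move=> N [TN cN]; split; [exact: phi_V0|exact/H].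
- move=> N N' /set_mem[TN _] /set_mem[TN' _]; exact: phi_inj.
- move=> I [VI pI]; have [N TN NI] := phi_surj VI; exists N => //.
  by split=> //; apply/H => //; rewrite NI.
Qed.

End MainBijection.

(** * Radicals, and setting y to 0 *)

Section Radical.
Context {k : fieldType}.
Implicit Types (I : set (biv k)) (f g : biv k).

Lemma radical_ideal I : is_ideal I -> is_ideal (radical I).
Proof.
move=> iI; split=> [|f g [n fn] [n' gn']|f g [n gn]].
- by exists 1; rewrite expr1; apply: ideal0.
- exists (n + n')%N; rewrite exprDn; apply: ideal_sum => // -[i /= ilt] _.
  rewrite -mulr_natl; apply: idealM => //.
  have [le|lt] := leqP n' i.
    by rewrite -(subnK le) exprD mulrA; apply: idealM.
  have -> : (n + n' - i = n' - i + n)%N by lia.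
  by rewrite exprD mulrAC; apply: idealM.
- by exists n; rewrite exprMn; apply: idealM.
Qed.

Lemma sub_radical I f : I f -> radical I f.
Proof. by exists 1; rewrite expr1. Qed.

Lemma radical_exp I f n : radical I (f ^+ n) -> radical I f.
Proof. by case=> n'; rewrite -exprM; exists (n * n')%N. Qed.

Lemma monic_dvdXn (p : {poly k}) n : p \is monic -> p %| 'X^n ->
  p = 'X^((size p).-1).
Proof.
move=> mon; rewrite -['X]subr0 -(polyC0 k) => /dvdp_exp_XsubCP[j _].
rewrite polyC0 subr0 eqp_monic ?monicXn // => /eqP ->.
by rewrite size_polyXn.
Qed.

Definition at_y0 : biv k -> {poly k} := map_poly (horner_eval 0).
HB.instance Definition _ := GRing.RMorphism.on at_y0.

Lemma at_y0Z (c : {poly k}) g : at_y0 (c *: g) = c`_0 *: at_y0 g.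
Proof. by rewrite /at_y0 map_polyZ /= /horner_eval horner_coef0. Qed.

Lemma at_y0D f g : at_y0 (f + g) = at_y0 f + at_y0 g.
Proof. exact: rmorphD. Qed.

Lemma at_y0B f g : at_y0 (f - g) = at_y0 f - at_y0 g.
Proof. exact: rmorphB. Qed.

Lemma at_y0M f g : at_y0 (f * g) = at_y0 f * at_y0 g.
Proof. exact: rmorphM. Qed.

Lemma at_y0_exp f n : at_y0 (f ^+ n) = at_y0 f ^+ n.
Proof. exact: rmorphXn. Qed.

Lemma at_y0_sum (J : Type) (s : seq J) (Q : pred J) (F : J -> biv k) :
  at_y0 (\sum_(i <- s | Q i) F i) = \sum_(i <- s | Q i) at_y0 (F i).
Proof. exact: rmorph_sum. Qed.

Lemma at_y0X : at_y0 'X = 'X.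
Proof. exact: map_polyX. Qed.

Lemma coef_at_y0 g i : (at_y0 g)`_i = g`_i`_0.
Proof. by rewrite coef_map /= /horner_eval horner_coef0. Qed.

Lemma at_y0_eq0 g : at_y0 g = 0 -> exists h, g = 'X *: h.
Proof.
move=> g0; exists (map_poly (fun p => p %/ 'X) g).
apply/polyP => i; rewrite coefZ coef_map_id0 ?div0p // mulrC divpK //.
by rewrite -['X]subr0 -(polyC0 k) dvdp_XsubCl /root horner_coef0 -coef_at_y0 g0 coef0.
Qed.

End Radical.

Section Powers.
Context {k : fieldType}.

(** The q_r stand for the cofactors P_r at y = 0. If all n_(r,c) with
    mu_r = mu_(c+1) vanish, then q_c = x q_(c+1) throughout. Conversely, let K
    be the last index with mu_K = mu_(c+1). From c + 1 to K the recursion is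
    multiplication by x, so q_r = x^(K - r) q_K for these r, and the relation
    at c shows that q_K divides q_c. Hence if q_c is a power of x, so are q_K
    and q_(c+1). Starting from q_0 = x^t, every q_c is a power of x, and each
    relation becomes a linear relation between distinct powers. *)
Lemma monic_powers_iff (t : nat) (mu : nat -> nat) (n : nat -> nat -> k)
    (q : nat -> {poly k}) :
    {homo mu : i j / (i <= j)%N} ->
    (forall r, (r <= t)%N -> q r \is monic /\ size (q r) = (t - r).+1) ->
    (forall c, (c < t)%N -> q c = 'X * q c.+1 -
      \sum_(c.+1 <= r < t.+1) (if mu r == mu c.+1 then n r c else 0) *: q r) ->
    (forall c, (c < t)%N -> mu c.+1 = mu c ->
       forall r, (c < r <= t)%N -> n r c = 0) ->
  q 0 = 'X^t <-> forall c r, (c < t)%N -> (c < r <= t)%N ->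
    mu r = mu c.+1 -> n r c = 0.
Proof.
move=> mu_homo qmon rel n0; split; last first.
  move=> nr0; rewrite -[in RHS](subn0 t).
  apply: (downward_ind (t := t) (P := fun r => q r = 'X^(t - r))) => //.
    have [mon sz] := qmon t (leqnn t); rewrite subnn in sz *.
    have /size_poly1P[x x0 qx] : size (q t) == 1 by rewrite sz.
    by move: mon; rewrite monicE qx lead_coefC => /eqP ->.
  move=> c ct IH; rewrite rel // IH ?ltnSn // big_nat_cond big1 => [|r].
    by rewrite subr0 -exprS subnSK.
  by rewrite andbT => crt; case: eqP => [/nr0->|]; rewrite ?scale0r.
move=> q0.
have qX c : (c <= t)%N -> q c = 'X^(t - c).
  elim: c => [|c IH] ct; first by rewrite subn0.
  have exP : exists r, [&& (c < r)%N, (r <= t)%N & mu r == mu c.+1].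
    by exists c.+1; rewrite ltnSn ct eqxx.
  have ubP r : [&& (c < r)%N, (r <= t)%N & mu r == mu c.+1] -> (r <= t)%N.
    by case/and3P.
  case: (ex_maxnP exP ubP) => K /and3P[cK Kt /eqP muK] Kmax.
  (* On the plateau the entries vanish, so each step down is a product by x. *)
  have plateau d : (d <= K - c.+1)%N -> q (K - d)%N = 'X^d * q K.
    elim: d => [|d IHd] dK; first by rewrite subn0 mul1r.
    have eS : (K - d.+1).+1 = (K - d)%N by lia.
    rewrite rel ?eS ?IHd; try lia.
    rewrite big_nat_cond big1 => [|r]; first by rewrite subr0 mulrA exprS.
    rewrite andbT => /andP[Kr rt]; rewrite n0 ?if_same ?scale0r //; try lia.
    rewrite eS; have := mu_homo c.+1 (K - d.+1)%N; have := mu_homo (K - d.+1)%N (K - d)%N.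
    by have := mu_homo (K - d)%N K; lia.
  have qr r : (c < r <= K)%N -> q r = 'X^(K - r) * q K.
    by move=> rK; rewrite -plateau; [congr q|]; lia.
  have [Kmon Ksz] := qmon K Kt.
  have : q K %| 'X^(t - c).
    rewrite -(IH (ltnW ct)) (rel c ct); apply: dvdp_sub.
      by apply: dvdp_mull; rewrite (qr c.+1) ?ltnSn // dvdp_mull.
    rewrite big_nat_cond; elim/big_ind: _ => [|x y|r]; first exact: dvdp0.
      exact: dvdp_add.
    rewrite andbT => /andP[cr rt]; case: eqP => [mur|]; last by rewrite scale0r dvdp0.
    by rewrite -mul_polyC dvdp_mull // (qr r) ?dvdp_mull // cr Kmax // cr mur eqxx andbT.
  move/(monic_dvdXn Kmon) => qK; rewrite qr ?ltnSn // qK Ksz -exprD.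
  by congr ('X^_); lia.
move=> c r ct /andP[cr rt] mur.
have := rel c ct; rewrite !qX // 1?ltnW // -exprS subnSK // => /eqP.
rewrite -subr_eq0 opprB addrCA subrr addr0 => /eqP.
move/(congr1 (fun p : {poly k} => p`_(t - r))); rewrite coef0 coef_sum.
rewrite (bigD1_seq r) ?mem_index_iota ?iota_uniq ?cr //= mur eqxx coefZ qX //.
rewrite coefXn eqxx mulr1 big_nat_cond big1 ?addr0 // => i /andP[/andP[ci it] ir].
rewrite coefZ qX // coefXn; have -> : (t - r == t - i)%N = false by lia.
by rewrite mulr0.
Qed.

End Powers.

(** * Conditions (1) and (2) *)

Section Cond12.
Context {k : fieldType} (E : set (biv k)).
Hypotheses (E_monomial : monomial_ideal E) (E_proper : E <> setT).
Hypothesis E_finite : finite_codim E.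
Local Notation t := (tE E).
Local Notation m := (mE E).
Implicit Types (N : 'M[{poly k}]_(t.+1, t)).

Let m0 : m 0 = 0%N := mE0 E_monomial E_finite.
Let m_homo : {homo m : i j / (i <= j)%N} := mE_homo E_monomial E_finite.

Lemma cond1_diag N : T0 E N -> cond1 E N <->
  forall c, (c < t)%N -> hb_entry N c c = 'X^(dE E c.+1).
Proof.
move=> TN; split=> H.
  move=> c ct; have ct1 : (c < t.+1)%N by apply: ltnW.
  by rewrite (hb_entryE N (Ordinal ct1) (Ordinal ct)) eqxx /= H // add0r.
move=> r c rc; have := H c (ltn_ord c); rewrite -{1}rc hb_entryE rc eqxx.
by move/(canRL (addrK _)); rewrite subrr.
Qed.

Lemma diag_powers N : (forall c, (c < t)%N -> hb_entry N c c = 'X^(dE E c.+1)) ->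
  forall r, (r <= t)%N -> diag_prod (hb_entry N) r = 'X^(m r).
Proof.
move=> H; elim=> [|r IH] rt; first by rewrite diag_prod0 m0.
by rewrite diag_prodS IH 1?ltnW // H // -exprD subnKC ?m_homo.
Qed.

(** D_t divides every element of I of x-degree 0. A monic divisor of a power
    of y is a power of y, and each b_(c,c) divides D_t. *)
Lemma cond1P N : T0 E N -> cond1 E N <-> radical (phi E N) 'Y.
Proof.
move=> TN; rewrite cond1_diag //; split=> [H|[n Yn]].
  exists (m t); rewrite -rmorphXn /= -(diag_powers H) //.
  by rewrite -(signed_minor_resolves TN).1; apply: signed_minor_mem.
have := phi_leads_divisible E_monomial E_finite TN (leqnn t) Yn.
rewrite subnn -rmorphXn size_polyC_leq1 /= coefC /= => /(_ isT) Dn c ct.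
have [mon sz _] := T0_hb_shape TN ct.
have -> : dE E c.+1 = (size (hb_entry N c c)).-1 by rewrite sz.
apply: (monic_dvdXn mon (n := n)); apply: dvdp_trans Dn.
by rewrite /diag_prod (bigD1 (Ordinal ct)) //= dvdp_mulr.
Qed.

Lemma kE_plateau c r : (c < r <= t)%N -> (r <= kE E c.+1)%N = (m r == m c.+1).
Proof.
move=> /andP[cr rt]; apply/idP/eqP => [rk|mr]; last first.
  have := @leq_bigmax_seq _ (index_iota c.+1 t.+1) (fun v => m v == m c.+1) id r.
  by rewrite mem_index_iota cr ltnS mr eqxx; apply.
have : kE E c.+1 = 0%N \/ m (kE E c.+1) = m c.+1.
  rewrite /kE; elim/big_ind: _ => [|x y Hx Hy|v /eqP]; [by left| |by right].
  by rewrite /maxn; case: ltnP.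
case=> [k0|mk]; first by move: rk cr; rewrite k0; lia.
by apply/eqP; rewrite eqn_leq (m_homo cr) -mk (m_homo rk).
Qed.

(** When d_j = 0 the degree bound makes the entries below the diagonal vanish,
    so the condition reads the same for every column. *)
Lemma cond2_plateau N : T0 E N -> cond2 E N <->
  forall c r, (c < t)%N -> (c < r <= t)%N -> m r = m c.+1 -> (hb_entry N r c)`_0 = 0.
Proof.
move=> TN; split=> H.
  move=> c r ct /andP[cr rt] mr; have rt1 : (r < t.+1)%N by [].
  rewrite (hb_entryE N (Ordinal rt1) (Ordinal ct)) /= gtn_eqF // addr0.
  have [d0|d0] := posnP (dE E c.+1); last first.
    by apply: (H (Ordinal ct) d0 (Ordinal rt1)) => /=; rewrite ltnS cr ltnS kE_plateau ?cr ?mr /=.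
  have := (TN (Ordinal rt1) (Ordinal ct)).2 (ltnW cr).
  by rewrite d0 size_poly_leq0 => /eqP ->; rewrite coef0.
move=> c _ r /andP[]; rewrite !ltnS => cr rk.
have rt : (r <= t)%N by rewrite -ltnS.
move: rk; rewrite kE_plateau ?cr // => /eqP mr.
have := H c r (ltn_ord c); rewrite cr rt hb_entryE gtn_eqF // addr0; exact.
Qed.

Section SetY0.
Variable N : 'M[{poly k}]_(t.+1, t).
Hypotheses (TN : T0 E N) (N1 : cond1 E N).
Local Notation f := (signed_minor N).
Let diagN := (cond1_diag TN).1 N1.
Let DX := diag_powers diagN.
Let resN := signed_minor_resolves TN.
Let echN := resolves_echelon (T0_hb_shape TN) resN.

(** The polynomial P_r with f_r = y^(m_r) P_r. *)
Definition minor_over_y (r : nat) : biv k := map_poly (fun p => p %/ 'X^(m r)) (f r).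
Local Notation P := minor_over_y.
Local Notation q r := (at_y0 (minor_over_y r)).

Lemma minor_over_yK r : (r <= t)%N -> 'X^(m r) *: P r = f r.
Proof.
move=> rt; apply/polyP => i; rewrite coefZ coef_map_id0 ?div0p // mulrC divpK //.
by rewrite -DX //; apply: (resolves_dvdp (T0_hb_shape TN) resN).
Qed.

(** The c-th relation divided by y^(m_(c+1)), the common power of y in all
    its terms. *)
Lemma minor_over_y_relation c : (c < t)%N -> P c = 'X * P c.+1 -
  \sum_(c.+1 <= r < t.+1) (hb_entry N r c * 'X^(m r - m c.+1)) *: P r.
Proof.
move=> ct; have Xn0 : ('X^(m c.+1))%:P != 0 :> biv k.
  by rewrite polyC_eq0 monic_neq0 ?monicXn.
apply: (mulfI Xn0); rewrite !mul_polyC scalerBr.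
have -> : 'X^(m c.+1) = 'X^(dE E c.+1) * 'X^(m c) :> {poly k}.
  by rewrite -exprD subnK // m_homo.
rewrite -{1}scalerA minor_over_yK 1?ltnW // -diagN // (resolves_step resN) //.
rewrite diagN // -exprD subnK ?m_homo // -minor_over_yK // scalerAr.
congr (_ - _); rewrite scaler_sumr; apply: eq_big_nat => r /andP[cr rt].
rewrite -minor_over_yK // !scalerA mulrCA mulrA; congr (_ *: _).
by rewrite -mulrA -exprD subnKC // m_homo.
Qed.

(** At y = 0 the factor y^(m_r - m_(c+1)) survives only when r lies on the
    plateau of c + 1. *)
Lemma minor_over_y0_relation c : (c < t)%N -> q c = 'X * q c.+1 -
  \sum_(c.+1 <= r < t.+1) (if m r == m c.+1 then (hb_entry N r c)`_0 else 0) *: q r.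
Proof.
move=> ct; rewrite {1}minor_over_y_relation // at_y0B at_y0M at_y0X at_y0_sum.
congr (_ - _); apply: eq_big_nat => r /andP[cr rt]; rewrite at_y0Z coefMXn.
have mr := m_homo cr; case: eqP => [->|ne]; first by rewrite subnn ltnn.
by have -> : (0 < m r - m c.+1)%N by lia.
Qed.

Lemma minor_over_y0_monic r : (r <= t)%N -> q r \is monic /\ size (q r) = (t - r).+1.
Proof.
move=> rt; have [sz lc] := echN rt.
have Pc : (P r)`_(t - r) = 1.
  by rewrite coef_map_id0 ?div0p // lc DX // divpp // monic_neq0 ?monicXn.
have szq : size (q r) = (t - r).+1.
  apply/eqP; rewrite eqn_leq; apply/andP; split.
    apply/leq_sizeP => j tj; rewrite coef_at_y0 coef_map_id0 ?div0p //.
    by rewrite (leq_sizeP _ _ sz) // div0p coef0.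
  rewrite ltnNge; apply/negP => /leq_sizeP/(_ _ (leqnn _)).
  by rewrite coef_at_y0 Pc coef1 => /eqP; rewrite oner_eq0.
by split=> //; rewrite monicE lead_coefE szq coef_at_y0 Pc coef1.
Qed.

Lemma cond2_minor_over_y0 : cond2 E N <-> q 0 = 'X^t.
Proof.
rewrite cond2_plateau // (monic_powers_iff (n := fun r c => (hb_entry N r c)`_0) (q := fun r => q r)
  m_homo
  minor_over_y0_monic minor_over_y0_relation) //.
move=> c ct mc r /andP[cr rt]; have [_ _ /(_ r)] := T0_hb_shape TN ct.
rewrite cr rt mc subnn => /(_ isT); rewrite size_poly_leq0 => /eqP ->.
exact: coef0.
Qed.

Lemma at_y0_minor0 : at_y0 (f 0) = q 0.
Proof. by rewrite -minor_over_yK // m0 scale1r. Qed.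

(** Here x^(t - 1) is not in E, so 0 < m_1 <= m_r. *)
Lemma at_y0_minor r : (0 < r <= t)%N -> at_y0 (f r) = 0.
Proof.
move=> /andP[r0 rt]; rewrite -minor_over_yK // at_y0Z coefXn.
have -> : (0 == m r)%N = false.
  have := m_homo r0; have := mE1_gt0 E_monomial E_proper E_finite; lia.
by rewrite scale0r.
Qed.

Lemma at_y0_phi g : phi E N g -> q 0 %| at_y0 g.
Proof.
rewrite phi_signed_minor => /(resolves_ideal_gen (T0_hb_shape TN) resN)[p [s ->]].
rewrite at_y0D at_y0M at_y0_minor0 at_y0_sum big_nat_cond big1 => [|r].
  by rewrite addr0 dvdp_mull.
by rewrite andbT => rt; rewrite at_y0Z at_y0_minor ?scaler0.
Qed.

(** If P_0(x,0) = x^t, then x^t differs from f_0 by a multiple of y, so x is in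
    the radical, as y is; and the constant term of a radical element vanishes
    because t > 0. If x^n is in I, then P_0(x,0) divides x^n. *)
Lemma cond2_radical : cond2 E N <-> radical (phi E N) = ideal_gen [set 'X; 'Y].
Proof.
rewrite cond2_minor_over_y0; have iI := phi_ideal N.
have iG := ideal_gen_ideal [set 'X; 'Y : biv k].
split=> [q0|radE]; last first.
  have [n Xn] : radical (phi E N) 'X by rewrite radE; apply: sub_ideal_gen; left.
  have := at_y0_phi Xn; rewrite at_y0_exp at_y0X.
  have [mon sz] := minor_over_y0_monic (leq0n t).
  by move/(monic_dvdXn mon) ->; rewrite sz subn0.
have iR := radical_ideal iI; have radY : radical (phi E N) 'Y by apply/cond1P.
apply/seteqP; split; last first.
  apply: ideal_gen_sub => // _ [->|->] //.
  apply: (radical_exp (n := t)).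
  have [|h hE] := at_y0_eq0 (g := f 0 - 'X^t).
    by rewrite at_y0B at_y0_exp at_y0_minor0 q0 at_y0X subrr.
  have -> : 'X^t = f 0 - h * 'Y by rewrite mulrC mul_polyC -hE opprB addrC subrK.
  apply: (idealB iR); last exact: (idealM iR).
  by apply: sub_radical; apply: signed_minor_mem.
move=> g [n gn]; apply: (ideal_of_occurs iG) => -[[|i] [|j]] occ.
- have := at_y0_phi gn; rewrite q0 at_y0_exp => /dvdpP[p].
  (* At the origin x^t vanishes, because t > 0. *)
  move/(congr1 (horner_eval 0)); rewrite rmorphXn rmorphM /= /horner_eval.
  rewrite !hornerXn expr0n [t == 0%N]eqn0Ngt tE_gt0 // mulr0.
  rewrite horner_coef0 coef_at_y0 => /eqP; rewrite expf_eq0 => /andP[_].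
  by move=> g0; move: occ; rewrite /occurs /= g0.
- rewrite /monom /= expr0 mul1r exprSr; apply: (idealM iG).
  by apply: sub_ideal_gen; right.
- rewrite /monom /= expr0 mulr1 exprSr; apply: (idealM iG).
  by apply: sub_ideal_gen; left.
- rewrite /monom /= ['Y ^+ j.+1]exprSr; do 2 apply: (idealM iG).
  by apply: sub_ideal_gen; right.
Qed.

End SetY0.
End Cond12.

(** * Homogeneous components and condition (3) *)

Section Homogeneous.
Context {k : fieldType}.
Implicit Types (I G : set (biv k)) (f g : biv k).

Definition hcomp d f : biv k := \poly_(i < d.+1) (f`_i`_(d - i) *: 'X^(d - i)).

Lemma coef_hcomp d f i j : (hcomp d f)`_i`_j = if (i + j == d)%N then f`_i`_j else 0.
Proof.
rewrite coef_poly; case: ltnP => [id|di]; last first.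
  by rewrite coef0; case: eqP => //; lia.
rewrite coefZ coefXn; have -> : (j == d - i)%N = (i + j == d)%N by lia.
by case: eqP => [<-|_]; rewrite ?mulr0 // addKn mulr1.
Qed.

Lemma hcompD d f g : hcomp d (f + g) = hcomp d f + hcomp d g.
Proof.
apply/biv_eqP => i j; rewrite !coefD !coef_hcomp !coefD.
by case: eqP; rewrite ?addr0.
Qed.

Lemma hcomp0 d : hcomp d 0 = 0 :> biv k.
Proof. by apply/biv_eqP => i j; rewrite coef_hcomp !coef0 if_same. Qed.

Lemma hcomp_sum d (J : Type) (s : seq J) (Q : pred J) (F : J -> biv k) :
  hcomp d (\sum_(i <- s | Q i) F i) = \sum_(i <- s | Q i) hcomp d (F i).
Proof. exact: (big_morph _ (hcompD d) (hcomp0 d)). Qed.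

Lemma hcompC d (c : k) f : hcomp d (c%:P *: f) = c%:P *: hcomp d f.
Proof.
apply/biv_eqP => i j; rewrite coefZ coefCM !coef_hcomp coefZ coefCM.
by case: eqP; rewrite ?mulr0.
Qed.

Lemma hcompX d f : hcomp d ('X * f) = if d is d'.+1 then 'X * hcomp d' f else 0.
Proof.
apply/biv_eqP => i j; rewrite coef_hcomp mulrC coefMX.
case: d => [|d]; first by case: i => [|i]; rewrite ?coef0 ?if_same.
rewrite [in RHS]mulrC coefMX; case: i => [|i] /=; first by rewrite coef0 if_same.
by rewrite coef_hcomp.
Qed.

Lemma hcompY d f : hcomp d ('X *: f) = if d is d'.+1 then 'X *: hcomp d' f else 0.
Proof.
apply/biv_eqP => i j; rewrite coef_hcomp coefZ mulrC coefMX.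
case: d => [|d]; first by rewrite !coef0; case: j => [|j]; rewrite ?if_same ?addnS.
rewrite coefZ [in RHS]mulrC coefMX; case: j => [|j] /=; first by rewrite if_same.
by rewrite coef_hcomp addnS.
Qed.

Lemma hcomp_homogeneous d f : hcomp d f = f -> homogeneous f.
Proof.
move=> hf; exists d => a; rewrite /occurs -hf coef_hcomp.
by have [//|_] := eqVneq (a.1 + a.2)%N d; rewrite eqxx.
Qed.

Lemma hcomp_fixed h d f : hcomp h f = f -> hcomp d f = if d == h then f else 0.
Proof.
move=> hf; case: eqP => [->//|ne]; apply/biv_eqP => i j.
rewrite coef_hcomp -hf coef_hcomp !coef0.
by do 2 case: eqP => //; lia.
Qed.

Lemma homogeneous_hcomp d f : homogeneous f -> hcomp d f = f \/ hcomp d f = 0.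
Proof.
move=> [h hf]; have hfE : hcomp h f = f.
  apply/biv_eqP => i j; rewrite coef_hcomp; case: eqP => // ne.
  have [->//|nz] := eqVneq f`_i`_j 0.
  by case: ne; apply: (hf (i, j)).
by rewrite (hcomp_fixed d hfE); case: eqP; [left|right].
Qed.

(** The polynomials all of whose components lie in I form an ideal, which
    contains the homogeneous generators. *)
Lemma homogeneous_ideal_hcomp I f d : homogeneous_ideal I -> I f -> I (hcomp d f).
Proof.
move=> [G Ghom ->] If; have iG := ideal_gen_ideal G.
suff sub : ideal_gen G `<=` [set g | forall e, ideal_gen G (hcomp e g)].
  exact: sub.
apply: ideal_gen_sub; last first.
  move=> g Gg e; case: (homogeneous_hcomp e (Ghom g Gg)) => ->.
    exact: sub_ideal_gen.
  exact: ideal0.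
apply: is_idealXYZ => [e|g h Hg Hh e|c g Hg e|g Hg e|g Hg e].
- by rewrite hcomp0; apply: ideal0.
- by rewrite hcompD; apply: (idealD iG).
- by rewrite hcompC; apply: (idealZ iG).
- by rewrite hcompX; case: e => [|e]; [apply: ideal0|apply: (idealM iG)].
- by rewrite hcompY; case: e => [|e]; [apply: ideal0|apply: (idealZ iG)].
Qed.

(** If f is homogeneous of degree h, only one monomial of n contributes to the
    component of degree H of n f. *)
Lemma hcomp_scale h H (n : {poly k}) f : hcomp h f = f ->
  hcomp H (n *: f) = (if (h <= H)%N then n`_(H - h) *: 'X^(H - h) else 0) *: f.
Proof.
move=> hf; elim/poly_ind: n H => [|n c IH] H.
  by rewrite scale0r hcomp0 coef0 scale0r if_same scale0r.
rewrite scalerDl mulrC -scalerA hcompD hcompC hcompY (hcomp_fixed _ hf).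
case: H => [|H].
  rewrite add0r leqn0 [0%N == h]eq_sym; have [->|_] := eqVneq h 0%N.
    by rewrite subnn expr0 coefD coefXM coefC !eqxx add0r alg_polyC.
  by rewrite scaler0 scale0r.
rewrite IH; case: (ltngtP h H.+1) => [hH|hH|->].
- rewrite ltnS in hH; rewrite hH scaler0 addr0 subSn // coefD coefXM coefC /= addr0.
  by rewrite scalerA exprS scalerAr.
- by rewrite leqNgt (ltnW hH) /= !scale0r !scaler0 addr0.
- by rewrite ltnn scale0r scaler0 add0r subnn coefD coefXM coefC !eqxx add0r alg_polyC.
Qed.

Lemma hcomp_Yn n : hcomp n ('X^n)%:P = ('X^n)%:P :> biv k.
Proof.
apply/biv_eqP => i j; rewrite coef_hcomp !coefC.
have [->|_] := eqVneq i 0%N; last by rewrite coef0 if_same.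
by rewrite add0n coefXn; case: eqVneq.
Qed.

End Homogeneous.

Section Cond3.
Context {k : fieldType} (E : set (biv k)).
Hypotheses (E_monomial : monomial_ideal E) (E_finite : finite_codim E).
Local Notation t := (tE E).
Local Notation m := (mE E).
Implicit Types (N : 'M[{poly k}]_(t.+1, t)).
(** The degree of x^(t - r) y^(m_r), the leading monomial of f_r. *)
Local Notation hdeg r := (t - r + m r)%N.
(** The part of the entry for which b_(r,c) f_r has the degree of x f_(c+1),
    when f_r and f_(c+1) are homogeneous. *)
Local Notation homog_entry N r c :=
  (if (hdeg r <= (hdeg c.+1).+1)%N
   then (hb_entry N r c)`_((hdeg c.+1).+1 - hdeg r) *: 'X^((hdeg c.+1).+1 - hdeg r)
   else 0).

Let m0 : m 0 = 0%N := mE0 E_monomial E_finite.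
Let m_homo : {homo m : i j / (i <= j)%N} := mE_homo E_monomial E_finite.

Lemma hdegS c : (c < t)%N -> (hdeg c.+1).+1 = (hdeg c + dE E c.+1)%N.
Proof. by move=> ct; have := m_homo (leqnSn c); rewrite /dE /=; lia. Qed.

(** The integer u_(r+1,c+1) is the degree of x f_(c+1) minus that of f_r, when
    f_r has degree t - r + m_r. *)
Lemma SE_hdeg r c : (c < t)%N -> (c < r <= t)%N -> SE E r.+1 c.+1 =
  (hdeg r <= (hdeg c.+1).+1)%N && ((hdeg c.+1).+1 - hdeg r < dE E c.+1)%N.
Proof.
move=> ct /andP[cr rt]; rewrite /SE /uE /= !ltnS cr rt /=.
by apply/idP/idP; lia.
Qed.

Lemma uE_hdeg r c : (c < t)%N -> (c < r <= t)%N -> (hdeg r <= (hdeg c.+1).+1)%N ->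
  `|uE E r.+1 c.+1|%N = ((hdeg c.+1).+1 - hdeg r)%N.
Proof. by move=> ct /andP[cr rt] le; rewrite /uE /=; lia. Qed.

(** For i > j and (i,j) outside S(E), either u_(i,j) is negative or it is at
    least d_j, which the degree bound forbids; both ways the homogeneous part
    of the entry is zero. *)
Lemma cond3_entry N : T0 E N -> cond3 E N <-> cond1 E N /\
  forall r c, (c < t)%N -> (c < r <= t)%N -> hb_entry N r c = homog_entry N r c.
Proof.
move=> TN; split=> [N3|[N1 NH] r c].
  split=> [r c rc|r c ct /andP[cr rt]].
    by have := N3 r c; rewrite /SE -rc ltnn andbF.
  have rt1 : (r < t.+1)%N by [].
  have := N3 (Ordinal rt1) (Ordinal ct).
  rewrite (hb_entryE N (Ordinal rt1) (Ordinal ct)) /= (gtn_eqF cr) addr0.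
  rewrite SE_hdeg ?cr //; case: ifP => [/andP[le _] [p ->]|_ ->]; last first.
    by rewrite coef0 scale0r if_same.
  by rewrite le uE_hdeg ?cr // coefZ coefXn eqxx mulr1.
have [cr|rc] := ltnP c r; last first.
  have -> : SE E r.+1 c.+1 = false by rewrite /SE !ltnS ltnNge rc.
  move: rc; rewrite leq_eqVlt => /orP[/eqP/N1//|rc].
  by case: (TN r c) => ->.
have rt : (r <= t)%N by rewrite -ltnS.
have Nrc : N r c = hb_entry N r c by rewrite hb_entryE (gtn_eqF cr) addr0.
rewrite SE_hdeg ?cr //; have := NH r c (ltn_ord c); rewrite cr rt => /(_ isT) NE.
case: ifP => [/andP[le _]|SEF].
  exists ((hb_entry N r c)`_((hdeg c.+1).+1 - hdeg r)); rewrite Nrc {1}NE le.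
  by rewrite uE_hdeg ?cr.
rewrite Nrc NE; case: ifP => // le; move: SEF; rewrite le /= => /negbT.
rewrite -leqNgt => dle; rewrite -Nrc (leq_sizeP _ _ ((TN r c).2 (ltnW cr))) //.
exact: scale0r.
Qed.

(** Given condition (3), each relation expresses y^(d_(c+1)) f_c by homogeneous
    terms of one degree, so f_c is homogeneous and I has homogeneous
    generators. If I is homogeneous, then y^(m_t), a component of f_t = D_t, is
    in I, so condition (1) holds. Descending on c, the component of degree
    t - c + m_c of f_c lies in I and has the leading coefficient of f_c, and
    the component of the relation keeps the degree bounds; uniqueness of
    the normalized column then gives homogeneity of f_c and of its entries. *)
Lemma cond3P N : T0 E N -> cond3 E N <-> homogeneous_ideal (phi E N).
Proof.
move=> TN; have sN := T0_hb_shape TN; have resN := signed_minor_resolves TN.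
have echN := resolves_echelon sN resN; have iI := phi_ideal N.
have lead := diag_prod_lead m0 m_homo sN.
split.
  case/(cond3_entry TN) => N1 NH; have diagN := (cond1_diag TN).1 N1.
  have DX := diag_powers E_monomial E_finite diagN.
  have Xn0 n : ('X^n)%:P != 0 :> biv k by rewrite polyC_eq0 monic_neq0 ?monicXn.
  suff fh : forall r, (r <= t)%N ->
      hcomp (hdeg r) (signed_minor N r) = signed_minor N r.
    exists (signed_minor N @` [set r | (r <= t)%N]); last exact: phi_signed_minor.
    by move=> _ [r /= rt <-]; apply: hcomp_homogeneous; apply: fh.
  apply: downward_ind => [|c ct IH].
    by rewrite resN.1 DX // subnn add0n hcomp_Yn.
  apply: (mulfI (Xn0 (dE E c.+1))); rewrite !mul_polyC.
  have := resolves_step resN ct; rewrite diagN // => stepE.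
  have IH1 := IH c.+1; rewrite ltnSn ct in IH1.
  have : hcomp (hdeg c + dE E c.+1) ('X^(dE E c.+1) *: signed_minor N c) =
      'X^(dE E c.+1) *: signed_minor N c.
    rewrite stepE -hdegS // -scaleN1r hcompD hcompX IH1 //; congr (_ + _).
    rewrite -polyCN hcompC hcomp_sum; congr (_ *: _); apply: eq_big_nat => r crt.
    by rewrite (hcomp_scale _ _ (IH r crt)) -NH.
  move=> <-.
  apply/biv_eqP => i j; rewrite coef_hcomp !coefZ !coefXnM coef_hcomp.
  case: ltnP => jd; first by rewrite if_same.
  by congr (if _ then _ else _); lia.
move=> homI; apply/(cond3_entry TN).
have N1 : cond1 E N.
  apply/(cond1P E_monomial E_finite TN); exists (m t).
  have [mon sz] := lead t (leqnn t).
  have := homogeneous_ideal_hcomp (m t) homI (signed_minor_mem (leqnn t)).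
  congr (phi E N _); apply/biv_eqP => i j.
  rewrite coef_hcomp resN.1 -rmorphXn /= !coefC.
  have [->|_] := eqVneq i 0%N; last by rewrite coef0 if_same.
  rewrite add0n coefXn; have [->|//] := eqVneq j (m t).
  by rewrite -[m t]/(m t).+1.-1 -sz -lead_coefE (monicP mon).
split=> //; have diagN := (cond1_diag TN).1 N1.
have DX := diag_powers E_monomial E_finite diagN.
have step c : (c < t)%N -> (forall r, (c < r <= t)%N ->
      hcomp (hdeg r) (signed_minor N r) = signed_minor N r) ->
    signed_minor N c = hcomp (hdeg c) (signed_minor N c) /\
    forall r, (c < r <= t)%N -> hb_entry N r c = homog_entry N r c.
  move=> ct fh; have [sz lc] := echN c (ltnW ct).
  have Dn0 i : (i <= t)%N -> diag_prod (hb_entry N) i != 0 by apply: (stair_lead_neq0 lead).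
  have szN r : (c < r <= t)%N -> (size (hb_entry N r c) <= dE E c.+1)%N.
    by move=> crt; case: (sN c ct) => _ _; apply.
  apply: (division_unique iI (@signed_minor_mem _ E N) echN
    (phi_leads_divisible E_monomial E_finite TN) Dn0 (a := 'X^(dE E c.+1))
    (n := fun r => hb_entry N r c) (n' := fun r => homog_entry N r c)).
  - exact: ltnW.
  - by apply: signed_minor_mem; apply: ltnW.
  - by apply: (homogeneous_ideal_hcomp _ homI); apply: signed_minor_mem; apply: ltnW.
  - exact: sz.
  - apply/leq_sizeP => j tj; apply/polyP => l; rewrite coef_hcomp.
    by rewrite (leq_sizeP _ _ sz) // coef0 if_same.
  - rewrite lc DX 1?ltnW //; apply/polyP => l; rewrite coef_hcomp eqn_add2l lc.
    by rewrite DX 1?ltnW // coefXn; case: eqP.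
  - by move=> r crt; rewrite size_polyXn ltnS szN.
  - move=> r crt; rewrite size_polyXn ltnS; case: ifP => _; last by rewrite size_poly0.
    apply: leq_trans (szN r crt); set u := (_ - _)%N.
    have [->|nz] := eqVneq (hb_entry N r c)`_u 0; first by rewrite scale0r size_poly0.
    rewrite size_scale // size_polyXn ltnNge; apply: contraNN nz => /leq_sizeP.
    by move->.
  have stepE := resolves_step resN ct; rewrite diagN // in stepE.
  have relE : 'X^(dE E c.+1) *: signed_minor N c +
      \sum_(c.+1 <= r < t.+1) hb_entry N r c *: signed_minor N r = 'X * signed_minor N c.+1.
    by rewrite stepE subrK.
  have fh1 : hcomp (hdeg c.+1) (signed_minor N c.+1) = signed_minor N c.+1.
    by apply: fh; rewrite ltnSn.
  rewrite relE -{1}fh1 -(hcompX (hdeg c.+1).+1) -relE hcompD hcomp_sum.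
  congr (_ + _); last first.
    by apply: eq_big_nat => r crt; rewrite (hcomp_scale _ _ (fh r crt)).
  rewrite hdegS //; apply/biv_eqP => i j; rewrite coef_hcomp !coefZ !coefXnM coef_hcomp.
  case: ltnP => jd; first by rewrite if_same.
  by congr (if _ then _ else _); lia.
have fh : forall r, (r <= t)%N ->
    hcomp (hdeg r) (signed_minor N r) = signed_minor N r.
  apply: downward_ind => [|c ct IH]; last by have [<-] := step c ct IH.
  by rewrite resN.1 DX // subnn add0n hcomp_Yn.
move=> r c ct crt; apply: (step c ct _).2 => // i /andP[_ it]; exact: fh.
Qed.

End Cond3.

(** * The bijections *)

Theorem theorem3p3 (k : fieldType) (E : set {poly {poly k}})
    (E_monomial : monomial_ideal E) (E_proper : E <> [set: {poly {poly k}}])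
    (E_finite : finite_codim E) :
  [/\ set_bij (T0 E) (V0 E) (phi E),
      set_bij (T1 E) (V1 E) (phi E),
      set_bij (T2 E) (V2 E) (phi E)
    & set_bij (T3 E) (V3 E) (phi E)].
Proof.
have restrict := set_bij_restrict E_monomial E_finite.
split.
- split.
  + by move=> N; apply: phi_V0.
  + by move=> N N' /set_mem TN /set_mem TN'; apply: phi_inj.
  + by move=> I /(phi_surj E_monomial E_finite)[N TN NI]; exists N.
- have -> : V1 E = [set I | V0 E I /\ radical I 'Y].
    by apply/seteqP; split=> [I [? ? ?]|I [[? ?] ?]].
  by apply: restrict => N; apply: cond1P.
- have -> : T2 E = [set N | T0 E N /\ (cond1 E N /\ cond2 E N)].
    by apply/seteqP; split=> [N [? ? ?]|N [? [? ?]]].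
  have -> : V2 E = [set I | V0 E I /\ radical I = ideal_gen [set 'X; 'Y]].
    by apply/seteqP; split=> [I [? ? ?]|I [[? ?] ?]].
  apply: restrict => N TN.
  have N1P := cond1P E_monomial E_finite TN.
  have N2P := cond2_radical E_monomial E_proper E_finite TN.
  split=> [[N1 /N2P]|radE]; first exact.
  have N1 : cond1 E N by apply/N1P; rewrite radE; apply: sub_ideal_gen; right.
  by split=> //; apply/N2P.
- have -> : V3 E = [set I | V0 E I /\ homogeneous_ideal I].
    by apply/seteqP; split=> [I [? ? ?]|I [[? ?] ?]].
  by apply: restrict => N; apply: cond3P.
Qed.
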